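(* Let $N\ge 1$ be an integer. Then $\mathrm{ospt}(N)$ is odd if and only if $24N-1=\ell^{4a+1}m^2$ for some prime $\ell\equiv 23\pmod{24}$, some integer $a\ge0$ and some integer $m\ge1$ with $\gcd(\ell,m)=1$.
   Context: For a partition $\lambda$, $\mathrm{rank}(\lambda)$ is the largest part of $\lambda$ minus the number of parts of $\lambda$. Let $o(\lambda)$ be the number of ones in $\lambda$ and $\mu(\lambda)$ the number of parts strictly larger than $o(\lambda)$; $\mathrm{crank}(\lambda)$ is the largest part of $\lambda$ if $o(\lambda)=0$, and $\mu(\lambda)-o(\lambda)$ if $o(\lambda)>0$. $M(m,N)$ (resp. $N(m,N)$) is the number of partitions of $N$ with crank (resp. rank) $m$, with the convention that for $N=1$ one sets $M(0,1)=-1$, $M(1,1)=M(-1,1)=1$ and $M(m,1)=0$ otherwise. Set $M_1^+(N):=\sum_{m\ge1}m\,M(m,N)$, $N_1^+(N):=\sum_{m\ge1}m\,N(m,N)$, and $\mathrm{ospt}(N):=M_1^+(N)-N_1^+(N)$. *)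

(* Defs.v *)
From HB Require Import structures.
From mathcomp Require Import all_boot all_order all_algebra.
Set Implicit Arguments.
Unset Strict Implicit.
Unset Printing Implicit Defensive.
Import Order.TTheory GRing.Theory Num.Theory.

Local Open Scope nat_scope.

Definition is_partition (N : nat) (s : seq nat) : bool :=
  [&& sorted geq s, 0 \notin s & sumn s == N].

(* A partition of N has at most N parts, all at most N, so the partitions of N
   live in a finite type; see [intpart_partition], [intpart_inj] and
   [intpart_surj] for the bijection with {s | is_partition N s}. *)
Definition parts (N : nat) (p : N.-bseq 'I_N.+1) : seq nat :=
  [seq val i | i <- p].

Definition intpart (N : nat) : {set N.-bseq 'I_N.+1} :=
  [set p | is_partition N (parts p)].

Definition largest_part (s : seq nat) : nat := \max_(x <- s) x.

Definition rank (s : seq nat) : int :=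
  ((largest_part s)%:Z - (size s)%:Z)%R.

Definition ones (s : seq nat) : nat := count_mem 1 s.

Definition mu (s : seq nat) : nat := count (fun x => ones s < x) s.

Definition crank (s : seq nat) : int :=
  if ones s == 0 then (largest_part s)%:Z%R
  else ((mu s)%:Z - (ones s)%:Z)%R.

Definition rank_count (m : int) (N : nat) : int :=
  #|[set p in intpart N | rank (parts p) == m]|%:Z%R.

(* The values at N = 1 are a convention, not the count of partitions of 1. *)
Definition crank_count (m : int) (N : nat) : int :=
  if N == 1 then
    (if m == 0 then -1 else if (m == 1) || (m == -1) then 1 else 0)%R
  else #|[set p in intpart N | crank (parts p) == m]|%:Z%R.

(* The sums over all m >= 1 are finite: the terms with m > N vanish, by
   [crank_count_eq0] and [rank_count_eq0]. *)
Definition crank_moment (N : nat) : int :=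
  (\sum_(1 <= m < N.+1) m%:Z * crank_count m%:Z N)%R.

Definition rank_moment (N : nat) : int :=
  (\sum_(1 <= m < N.+1) m%:Z * rank_count m%:Z N)%R.

Definition ospt (N : nat) : int := (crank_moment N - rank_moment N)%R.

Lemma mem_leq_sumn (s : seq nat) x : x \in s -> x <= sumn s.
Proof.
elim: s => //= y s IH; rewrite inE => /orP[/eqP->|/IH h]; first exact: leq_addr.
exact: leq_trans h (leq_addl _ _).
Qed.

Lemma size_leq_sumn (s : seq nat) : 0 \notin s -> size s <= sumn s.
Proof.
elim: s => //= y s IH; rewrite inE negb_or eq_sym -lt0n => /andP[y0 /IH h].
by rewrite -add1n leq_add.
Qed.

Lemma intpart_partition (N : nat) (p : N.-bseq 'I_N.+1) :
  p \in intpart N -> is_partition N (parts p).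
Proof. by rewrite inE. Qed.

Lemma intpart_inj (N : nat) : injective (@parts N).
Proof. by move=> p q /(inj_map val_inj) /val_inj. Qed.

Lemma intpart_surj (N : nat) (s : seq nat) :
  is_partition N s -> exists2 p, p \in intpart N & parts p = s.
Proof.
move=> hs; have /and3P[_ s0 /eqP sN] := hs.
pose t : seq 'I_N.+1 := [seq inord x | x <- s].
have ht : size t <= N by rewrite size_map -sN size_leq_sumn.
have et : [seq val i | i <- t] = s.
  rewrite -map_comp -[RHS]map_id; apply/eq_in_map => x /mem_leq_sumn.
  by rewrite sN => xN; rewrite /= inordK.
by exists (Bseq ht) => //; rewrite inE /parts /= et.
Qed.

Lemma largest_part_leq (N : nat) (s : seq nat) :
  is_partition N s -> largest_part s <= N.
Proof.
case/and3P=> _ _ /eqP sN; apply/bigmax_leqP_seq => x xs _.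
by rewrite -sN mem_leq_sumn.
Qed.

Lemma mu_leq (N : nat) (s : seq nat) : is_partition N s -> mu s <= N.
Proof.
case/and3P=> _ s0 /eqP sN; apply: leq_trans (count_size _ _) _.
by rewrite -sN size_leq_sumn.
Qed.

Lemma rank_count_eq0 (m N : nat) : N < m -> rank_count m%:Z%R N = 0%R.
Proof.
move=> Nm; congr Posz; apply/eqP; rewrite cards_eq0; apply/eqP/setP => p.
rewrite !inE; apply/negP => /andP[/largest_part_leq h /eqP e].
have : (m%:Z <= N%:Z)%R.
  rewrite -e /rank; apply: le_trans (_ : (largest_part (parts p))%:Z <= _)%R.
    by rewrite lerBlDr lerDl.
  by rewrite lez_nat.
by rewrite lez_nat leqNgt Nm.
Qed.

Lemma crank_count_eq0 (m N : nat) : N < m -> crank_count m%:Z%R N = 0%R.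
Proof.
move=> Nm; rewrite /crank_count; case: ifP => [/eqP N1|_].
  by move: Nm; rewrite N1; case: m => [|[|m]].
congr Posz; apply/eqP; rewrite cards_eq0; apply/eqP/setP => p.
rewrite !inE; apply/negP => /andP[hp /eqP e].
have : (m%:Z <= N%:Z)%R.
  rewrite -e /crank; case: ifP => _; first by rewrite lez_nat largest_part_leq.
  apply: le_trans (_ : (mu (parts p))%:Z <= _)%R.
    by rewrite lerBlDr lerDl.
  by rewrite lez_nat mu_leq.
by rewrite lez_nat leqNgt Nm.
Qed.

(* Main.v *)
Require Import Defs.
From mathcomp Require Import all_boot all_order all_algebra.
From mathcomp Require Import zify ring.

(** Everything is modulo 2. Write [p] for the partition function. Dyson's
    recurrence for the partitions of rank at least [r], and its analogue for
    the crank, expand [M_1^+] and [N_1^+] as sums of values of [p]; most terms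
    cancel and [ospt N] becomes the sum of [p (N - E)] over
    [E = n (n - 1) / 2 + n r], [1 <= r <= n]. By the pentagonal number theorem
    it remains to show that the number [D E] of such pairs [(n, r)] has the
    parity of the number of solutions of
    [144 k^2 + c^2 = w^2 + 24 E], [w < 12 k], with [c] prime to 6, for then
    [ospt N] has the parity of the number of solutions of
    [144 k^2 - w^2 = 24 N - 1]: half the number of divisors of [24 N - 1], which
    is odd exactly for the integers [l^(4a+1) m^2] of the statement.

    The solutions of the ternary equation are indefinite binary quadratic forms,
    i.e. geodesics of the hyperbolic plane, that separate the cusps -1 and 1,
    up to [Y -> - Y]. A geodesic crosses an even number of sides of an ideal
    triangle, so modulo 2 this count reduces to the geodesics crossing
    [(0, oo)] or [(1, oo)]. The reflections in these two lines preserve the set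
    of forms; their fixed points have [k = 0] or [p = 2 k] and correspond to
    factorisations of [E], which are compared with [D E]. *)

Set Implicit Arguments.
Unset Strict Implicit.
Unset Printing Implicit Defensive.

Import Order.TTheory GRing.Theory Num.Theory.

(** * Counting by bijections, and modulo 2 by involutions *)

Lemma count_bij (T U : eqType) (s : seq T) (t : seq U) (P : pred T) (Q : pred U)
    (f : T -> U) (g : U -> T) :
  uniq s -> uniq t ->
  (forall x, x \in s -> P x -> [/\ f x \in t, Q (f x) & g (f x) = x]) ->
  (forall y, y \in t -> Q y -> [/\ g y \in s, P (g y) & f (g y) = y]) ->
  count P s = count Q t.
Proof.
move=> us ut fP gP; rewrite -!size_filter -(size_map f); apply: perm_size.
apply: uniq_perm; last 1 first.
- move=> y; apply/mapP/idP => [[x]|].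
    by rewrite !mem_filter => /andP[Px xs] ->; have [-> -> _] := fP x xs Px.
  rewrite mem_filter => /andP[Qy yt]; have [ys Py fy] := gP y yt Qy.
  by exists (g y); rewrite ?mem_filter ?Py.
- rewrite map_inj_in_uniq ?filter_uniq // => x y; rewrite !mem_filter.
  move=> /andP[Px xs] /andP[Py ys] e.
  by have [_ _ <-] := fP x xs Px; have [_ _ <-] := fP y ys Py; rewrite e.
- exact: filter_uniq.
Qed.

(** The points that are not fixed pair off and cancel; the induction removes a point together with
    its image. *)
Lemma odd_count_invol (T : eqType) (s : seq T) (P : pred T) (f : T -> T) :
  uniq s ->
  (forall x, x \in s -> P x -> [/\ f x \in s, P (f x) & f (f x) = x]) ->
  odd (count P s) = odd (count (fun x => P x && (f x == x)) s).
Proof.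
rewrite -(size_filter P) => us fP.
have -> : count (fun x => P x && (f x == x)) s =
          count (fun x => f x == x) (filter P s).
  by rewrite count_filter; apply: eq_count => x /=; rewrite andbC.
have {us}: uniq (filter P s) by rewrite filter_uniq.
have {fP}: forall x, x \in filter P s -> f x \in filter P s /\ f (f x) = x.
  move=> x; rewrite mem_filter => /andP[Px xs]; have [? ? ?] := fP x xs Px.
  by rewrite mem_filter; split=> //; apply/andP.
move: (filter P s) => {P}{}s.
have [n] := ubnP (size s); elim: n s => // n IH [|x s] //= le_n fP /andP[xs us].
have [fx ffx] := fP x (mem_head _ _).
case: (eqVneq (f x) x) => [e|ne].
  rewrite /= (_ : odd (size s) = odd (count (fun y => f y == y) s)) //.
  apply: IH => // y ys; have [|fy ffy] := fP y; first by rewrite inE ys orbT.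
  split=> //; move: fy; rewrite inE => /orP[/eqP fyx|//].
  by move: xs; rewrite -e -fyx ffy ys.
move: fx; rewrite inE (negPf ne) /= add0n => fxs.
rewrite (perm_size (perm_to_rem fxs)) /= negbK.
rewrite (permP (perm_to_rem fxs)) /= ffx eq_sym (negPf ne) add0n.
have sr : size (rem (f x) s) = (size s).-1 by rewrite size_rem.
apply: IH; first by lia.
  move=> y; rewrite (rem_filter _ us) !mem_filter /= => /andP[yfx ys].
  have [|fy ffy] := fP y; first by rewrite inE ys orbT.
  split=> //; move: fy; rewrite inE => /orP[/eqP fyx|->].
    by move: yfx; rewrite -fyx ffy eqxx.
  rewrite andbT; apply/eqP => e.
  by move: xs; rewrite -ffx -e ffy ys.
exact: rem_uniq.
Qed.

Lemma odd_count_split (T : Type) (s : seq T) (P Q : pred T) :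
  odd (count P s) = odd (count (predI P Q) s) (+) odd (count (predI P (predC Q)) s).
Proof.
rewrite -oddD; congr odd; elim: s => //= x s ->.
by case: (P x); case: (Q x) => /=; lia.
Qed.

(** * Lists of partitions and their Young diagrams *)

Definition partitions (N : nat) : seq (seq nat) :=
  [seq parts p | p <- enum (intpart N)].

Lemma uniq_partitions N : uniq (partitions N).
Proof. by rewrite map_inj_uniq ?enum_uniq //; exact: intpart_inj. Qed.

Lemma mem_partitions N s : (s \in partitions N) = is_partition N s.
Proof.
apply/mapP/idP => [[p]|/intpart_surj[p pN <-]].
  by rewrite mem_enum => /intpart_partition h ->.
by exists p; rewrite ?mem_enum.
Qed.

Lemma count_partitions N (P : pred (seq nat)) :
  #|[set p in intpart N | P (parts p)]| = count P (partitions N).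
Proof.
rewrite count_map -size_filter cardE; congr size.
rewrite /enum_mem -enumT /= -filter_predI.
by apply: eq_filter => p; rewrite /= !inE andbC.
Qed.

Lemma geq_trans : transitive geq.
Proof. by move=> y x z /= h1 h2; apply: leq_trans h2 h1. Qed.

Lemma leq_nth_sorted (s : seq nat) i j :
  sorted geq s -> i <= j -> nth 0 s j <= nth 0 s i.
Proof.
move=> ss ij; case: (ltnP j (size s)) => js; last by rewrite (nth_default _ js).
have h := @sorted_leq_nth _ _ geq_trans leqnn 0 _ ss i j.
by rewrite !inE in h; apply: h; lia.
Qed.

(** Both sides say that the cell in row [i] and column [j] lies in the Young diagram of [s]. This
    symmetry underlies conjugation and the crank regions below. *)
Lemma ltn_count_nth (s : seq nat) i j :
  sorted geq s -> (i < count (fun x => j < x) s) = (j < nth 0 s i).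
Proof.
elim: s i => [|x s IH] i /=; first by rewrite nth_nil.
move=> ps; have ss := path_sorted ps.
have ax : all (geq x) s by exact: order_path_min geq_trans ps.
case: i => [|i] /=.
  case: (ltnP j x) => //= xj; rewrite add0n; apply/negbTE.
  rewrite -has_count; apply/hasPn => y ys; rewrite -leqNgt.
  by move/allP: ax => /(_ y ys) /=; lia.
case: (ltnP j x) => xj; first by rewrite add1n ltnS IH.
rewrite add0n; have := IH 0 ss; have := leq_nth_sorted (i:=0) (j:=i) ss.
have : nth 0 s 0 <= x by case: (s) ax => //= y s' /andP[].
have := IH i ss; move: (count _ _) (nth 0 s i) (nth 0 s 0) => c y z.
lia.
Qed.

(** * Partitions and the rank *)

Lemma pairwise_geq (s : seq nat) : sorted geq s = pairwise geq s.
Proof. exact: sorted_pairwise geq_trans s. Qed.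

Lemma is_partitionE N (s : seq nat) :
  is_partition N s = [&& pairwise geq s, all (leq 1) s & sumn s == N].
Proof.
rewrite /is_partition pairwise_geq; congr [&& _, _ & _].
elim: s => //= x s <-; rewrite inE negb_or; case: x => //.
Qed.

Lemma mem_partitionsP N (s : seq nat) :
  reflect [/\ pairwise geq s, all (leq 1) s & sumn s = N] (s \in partitions N).
Proof.
rewrite mem_partitions is_partitionE.
by apply: (iffP and3P) => -[? ? /eqP ?]; split=> //; apply/eqP.
Qed.

Lemma largest_part_head (s : seq nat) : pairwise geq s -> largest_part s = head 0 s.
Proof.
rewrite /largest_part; case: s => [|x s] /=; first by rewrite big_nil.
case/andP=> /allP xs _; rewrite big_cons; apply/maxn_idPl.
by apply/bigmax_leqP_seq => y ys _; exact: xs.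
Qed.

Lemma cat_filter_geq (s : seq nat) j : pairwise geq s ->
  [seq x <- s | j < x] ++ [seq x <- s | x <= j] = s.
Proof.
elim: s => //= x s IH /andP[/allP xs /IH e].
case: (ltnP j x) => /= xj; first by rewrite e.
have e0 : [seq y <- s | j < y] = [::].
  apply/eqP; rewrite -[_ == _]negbK -has_filter.
  by apply/hasPn => y /xs /= yx; rewrite -leqNgt (leq_trans yx).
by rewrite -[in RHS]e e0.
Qed.

Lemma filter_ones (s : seq nat) : all (leq 1) s ->
  [seq x <- s | x <= 1] = nseq (size s - count (leq 2) s) 1.
Proof.
elim: s => //= x s IH /andP[x0 /IH ->].
case: (ltngtP x 1) => [|_|->]; first by case: x x0.
  by rewrite add1n subSS.
by rewrite add0n subSn ?count_size.
Qed.

Lemma sumn_map_succ (s : seq nat) : sumn [seq x.+1 | x <- s] = sumn s + size s.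
Proof. by elim: s => //= x s ->; lia. Qed.

Lemma size_le_sumn (s : seq nat) : all (leq 1) s -> size s <= sumn s.
Proof. by elim: s => //= y s IH /andP[y0 /IH]; lia. Qed.

Lemma sumn_map_pred (s : seq nat) : all (leq 1) s ->
  sumn [seq x.-1 | x <- s] = sumn s - size s.
Proof.
elim: s => //= x s IH /andP[x0 a]; rewrite IH //.
by have := size_le_sumn a; lia.
Qed.

Definition rank_ge r N :=
  count (fun s => size s + r <= head 0 s) (partitions N).

(* Dyson's map: replace the largest part by a column. *)
Lemma rank_ge_rec r N : r < N ->
  rank_ge r N + rank_ge (r + 3) (N - r.+1) = size (partitions (N - r.+1)).
Proof.
move=> rN; rewrite -[RHS](count_predC (fun s => size s + (r + 3) <= head 0 s)).
rewrite addnC; congr addn.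
(* The largest part [a] is removed, the other parts grow by 1, and ones are added up to [a - r.+1]
   parts. The new largest part is at most [a + 1], so the new rank is at most [r + 2]: hence the
   [r + 3] of the statement. The inverse [g] recovers [a] from the number of parts. *)
pose f s := let t := behead s in
  [seq x.+1 | x <- t] ++ nseq (head 0 s - r.+1 - size t) 1.
pose g s := size s + r.+1 :: [seq x.-1 | x <- s & 1 < x].
apply: (@count_bij _ _ _ _ _ _ f g); rewrite ?uniq_partitions //.
  move=> s /mem_partitionsP[+ + sN]; case: s sN => [|a t] /=; first by lia.
  rewrite /f /g /= => sN /andP[at_ pt] /andP[a0 t0] h; split.
  - apply/mem_partitionsP; split.
    + rewrite pairwise_cat pairwise_map -[pairwise _ t]/(pairwise geq t) pt /=.
      apply/andP; split; last by elim: (_ - _) => //= n ->; rewrite all_nseq orbT.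
      by apply/allrelP => x y /mapP[z _ ->] /nseqP[-> _].
    + by rewrite all_cat all_nseq orbT andbT; apply/allP => x /mapP[z _ ->].
    + by rewrite sumn_cat sumn_map_succ sumn_nseq; lia.
  - rewrite size_cat size_map size_nseq -ltnNge.
    case: t at_ {t0 sN pt} h => [|b t] /=; last by move=> /andP[]; lia.
    by move=> _; case: (_ - _) => //=; lia.
  - congr cons; first by rewrite size_cat size_map size_nseq; lia.
    rewrite filter_cat map_cat [filter _ (nseq _ _)](_ : _ = [::]); last first.
      by elim: (_ - _) => //=.
    rewrite cats0 (_ : filter _ _ = [seq x.+1 | x <- t]).
      by rewrite -map_comp map_id_in.
    by apply/all_filterP/allP => x /mapP[z zt ->]; move/allP: t0 => /(_ z zt).
move=> /= s /mem_partitionsP[ps s0 sN]; rewrite /f /g /= -ltnNge => h.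
have e := cat_filter_geq 1 ps.
have c := count_size (leq 2) s.
have es : sumn [seq x <- s | 1 < x] + (size s - count (leq 2) s) = sumn s.
  by rewrite -[in RHS]e sumn_cat filter_ones // sumn_nseq mul1n.
have a1 : all (leq 1) [seq x <- s | 1 < x].
  by apply/allP => x; rewrite mem_filter => /andP[/ltnW].
split.
- apply/mem_partitionsP; split=> /=.
  + apply/andP; split.
      apply/allP => x /mapP[y]; rewrite mem_filter => /andP[y1 ys] ->.
      have : y <= head 0 s; last by rewrite /=; lia.
      by rewrite -largest_part_head // /largest_part (big_rem y ys) /= leq_maxl.
    rewrite pairwise_map; apply: sub_pairwise (pairwise_filter _ ps).
    by move=> x y /=; lia.
  + rewrite addnS /= all_map; apply/allP => x; rewrite mem_filter /=; lia.
  + rewrite sumn_map_pred // size_filter; have := size_le_sumn a1.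
    rewrite size_filter; move: (count _ s) c es. lia.
- by rewrite size_map size_filter; move: (count _ s) c; lia.
- rewrite -[RHS]e filter_ones // size_map size_filter; congr cat.
    by rewrite -map_comp map_id_in // => x; rewrite mem_filter /=; lia.
  by rewrite addnK.
Qed.

Lemma rank_ge_small r N : 0 < r -> N <= r -> rank_ge r N = 0.
Proof.
move=> r0 Nr; apply/eqP; rewrite -leqn0 leqNgt -has_count; apply/hasPn => s.
case/mem_partitionsP => ps s0 sN; rewrite -ltnNge.
case: s ps s0 sN => [|x s] /=; first by lia.
by lia.
Qed.

(** * Conjugation *)

Definition conj_part (s : seq nat) : seq nat :=
  [seq count (leq j.+1) s | j <- iota 0 (head 0 s)].

Lemma head_geq (s : seq nat) x : pairwise geq s -> x \in s -> x <= head 0 s.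
Proof.
by case: s => //= y s /andP[/allP ys _]; rewrite inE => /predU1P[->|/ys].
Qed.

Lemma nth_conj_part (s : seq nat) i : pairwise geq s ->
  nth 0 (conj_part s) i = count (leq i.+1) s.
Proof.
move=> ps; case: (ltnP i (head 0 s)) => hi.
  by rewrite (nth_map 0) ?size_iota // nth_iota.
rewrite nth_default ?size_map ?size_iota //; apply/esym/eqP.
rewrite eqn0Ngt -has_count; apply/hasPn => x /(head_geq ps) /=; lia.
Qed.

Lemma count_ltn_iota h x : count (fun j => j < x) (iota 0 h) = minn h x.
Proof. by elim: h => [|h IH]; rewrite ?min0n // -addn1 iotaD count_cat IH /=; lia. Qed.

Lemma sumn_count_ltn (s : seq nat) h : all (geq h) s ->
  sumn [seq count (leq j.+1) s | j <- iota 0 h] = sumn s.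
Proof.
elim: s => [|x s IH] /=; first by elim: (iota 0 h).
move=> /andP[xh /IH <-]; rewrite -[in RHS](minn_idPr xh) -count_ltn_iota.
by elim: (iota 0 h) => //= j t ->; lia.
Qed.

Lemma conj_part_partition N (s : seq nat) :
  s \in partitions N -> conj_part s \in partitions N.
Proof.
move=> /mem_partitionsP[ps s0 sN]; apply/mem_partitionsP; split.
- have : pairwise ltn (iota 0 (head 0 s)).
    by rewrite -sorted_pairwise ?iota_ltn_sorted //; exact: ltn_trans.
  rewrite pairwise_map; apply: sub_pairwise => i j /= ij.
  by apply: sub_count => x /=; lia.
- apply/allP => x /mapP[j]; rewrite mem_iota /= add0n => jh ->.
  by rewrite -has_count; case: s jh {ps s0 sN} => //= x' s ->.
- by rewrite sumn_count_ltn //; apply/allP => x /(head_geq ps).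
Qed.

Lemma size_conj_part (s : seq nat) : size (conj_part s) = head 0 s.
Proof. by rewrite size_map size_iota. Qed.

Lemma head_conj_part N (s : seq nat) :
  s \in partitions N -> head 0 (conj_part s) = size s.
Proof.
move=> /mem_partitionsP[ps s0 _]; rewrite -nth0 nth_conj_part //.
by apply/eqP; rewrite -all_count.
Qed.

Lemma conj_partK N (s : seq nat) : s \in partitions N -> conj_part (conj_part s) = s.
Proof.
move=> sN; have cN := conj_part_partition sN.
have /mem_partitionsP[ps _ _] := sN; have /mem_partitionsP[pc _ _] := cN.
apply: (@eq_from_nth _ 0); first by rewrite size_conj_part (head_conj_part sN).
move=> i _; rewrite nth_conj_part //.
(* By the cell symmetry, used twice, the two entries exceed the same integers [j], so they are
   equal. *)
have e j : (j < count (leq i.+1) (conj_part s)) = (j < nth 0 s i).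
  rewrite ltn_count_nth ?pairwise_geq // nth_conj_part //.
  by rewrite ltn_count_nth ?pairwise_geq.
by move: (e (nth 0 s i)) (e (count (leq i.+1) (conj_part s))); lia.
Qed.

(** Conjugation negates the rank, so negative ranks correspond to positive ones. *)
Lemma rank_ge01 N : rank_ge 0 N + rank_ge 1 N = size (partitions N).
Proof.
rewrite -[RHS](count_predC (fun s => size s + 0 <= head 0 s)); congr addn.
apply: (@count_bij _ _ _ _ _ _ conj_part conj_part); rewrite ?uniq_partitions //.
  move=> /= s sN h; split; [exact: conj_part_partition| |exact: conj_partK sN].
  rewrite /= size_conj_part (head_conj_part sN); lia.
move=> /= s sN h; split; [exact: conj_part_partition| |exact: conj_partK sN].
by rewrite /= size_conj_part (head_conj_part sN); lia.
Qed.

(** * The crank *)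

(* The Andrews-Garvan crank generating function is
   [(1 - q) \sum_j (q / z)^j / ((q)_j (z q^(j+1))_oo)]. Without the factor
   [1 - q] it counts pairs [(j, t)] by the number of parts of [t] larger than
   [j], minus [j]; this is at least [r] when the conjugate of [t] satisfies
   [crank_region r]. *)
Definition marked_partitions (N : nat) : seq (nat * seq nat) :=
  [seq (j, s) | j <- iota 0 N.+1, s <- partitions (N - j)].

Lemma uniq_marked_partitions N : uniq (marked_partitions N).
Proof.
apply: allpairs_uniq_dep => [|j _|]; rewrite ?iota_uniq ?uniq_partitions //.
by move=> [j s] [k t] _ _ /= [-> ->].
Qed.

Lemma mem_marked_partitionsP N (x : nat * seq nat) :
  reflect [/\ pairwise geq x.2, all (leq 1) x.2 & x.1 + sumn x.2 = N]
          (x \in marked_partitions N).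
Proof.
apply: (iffP allpairsPdep) => [[j [s [+ + ->]]]|].
  by rewrite mem_iota => jN /mem_partitionsP[? ? ?]; split=> //=; lia.
case: x => j s /= [ps s0 sN]; exists j, s; split=> //.
  by rewrite (mem_iota 0 N.+1); lia.
by apply/mem_partitionsP; split=> //; lia.
Qed.

(** There are p(0) + ... + p(N) pairs of total [N], so differencing in [N], i.e. multiplying by 1 -
    q, recovers p. *)
Lemma size_marked_partitions N :
  size (marked_partitions N.+1) = size (marked_partitions N) + size (partitions N.+1).
Proof.
have e M : size (marked_partitions M) = \sum_(i < M.+1) size (partitions i).
  rewrite size_allpairs_dep sumnE big_map -[iota _ _]/(index_iota 0 M.+1).
  rewrite big_nat_rev big_mkord; apply: eq_bigr => -[i iM] _.
  by rewrite /= (_ : M - _ = i) //; lia.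
by rewrite !e big_ord_recr.
Qed.

Definition crank_region r (x : nat * seq nat) := x.1 + r <= nth 0 x.2 x.1.

Definition marked_ge r N := count (crank_region r) (marked_partitions N).

Lemma marked_ge_small r N : 0 < r -> N < r -> marked_ge r N = 0.
Proof.
move=> r0 Nr; apply/eqP; rewrite -leqn0 leqNgt -has_count; apply/hasPn => /= -[j s].
case/mem_marked_partitionsP => /= ps s0 sN; rewrite /crank_region /= -ltnNge.
case: (ltnP j (size s)) => js; last by rewrite nth_default //; lia.
by have le : nth 0 s j <= sumn s := mem_leq_sumn (mem_nth 0 js); lia.
Qed.

Lemma filter_map_succ h (s : seq nat) : all (leq h) s ->
  [seq x <- [seq y.+1 | y <- s] | h < x] = [seq y.+1 | y <- s].
Proof. by elim: s => //= x s IH /andP[hx /IH ->]; rewrite ltnS hx. Qed.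

(* With [t = j + r], a pair outside the smaller region goes to the one obtained
   by decreasing the parts larger than [t] and inserting the part [t] after
   them, the position of which becomes the new mark. *)
Lemma marked_ge_rec r N : 0 < r -> r <= N ->
  marked_ge r N + marked_ge r.+1 (N - r) = size (marked_partitions (N - r)).
Proof.
move=> r0 rN; rewrite -[RHS](count_predC (crank_region r.+1)) addnC; congr addn.
(* The part [t] at the mark is deleted, the [j] parts before it grow by 1, and [t - r] becomes the
   mark: the total drops by [r]. *)
pose f (x : nat * seq nat) := (nth 0 x.2 x.1 - r,
  [seq y.+1 | y <- take x.1 x.2] ++ drop x.1.+1 x.2).
pose g (x : nat * seq nat) := let t := x.1 + r in
  (count (leq t.+1) x.2,
   [seq y.-1 | y <- x.2 & t < y] ++ t :: [seq y <- x.2 | y <= t]).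
apply: (@count_bij _ _ _ _ _ _ f g); rewrite ?uniq_marked_partitions //.
  move=> /= -[j s] /mem_marked_partitionsP[/= ps s0 sN].
  rewrite /crank_region /= => h.
  have js : j < size s by case: ltnP => // js; move: h; rewrite nth_default //; lia.
  rewrite /f /g /=; set b := drop _ _; set a := take _ _; set t := nth 0 s j in h *.
  have es : s = a ++ t :: b by rewrite -drop_nth // cat_take_drop.
  have sa : size a = j by rewrite size_take js.
  move: ps s0 sN; rewrite es pairwise_cat all_cat sumn_cat /=.
  move=> /and3P[/allrelP ab pa /andP[/allP tb pb]] /and3P[a0 t0 b0] sN.
  have at_ x : x \in a -> t <= x by move=> xa; apply: (ab x t xa); rewrite mem_head.
  have rt : t - r + r = t by lia.
  rewrite rt; split.
  - apply/mem_marked_partitionsP; split=> /=.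
    + rewrite pairwise_cat pairwise_map -[pairwise _ a]/(pairwise geq a) pa pb !andbT.
      apply/allrelP => x y /mapP[z za ->] yb /=.
      by have := ab z y za; rewrite inE yb orbT /= => /(_ isT); lia.
    + by rewrite all_cat b0 andbT; apply/allP => x /mapP[z _ ->].
    + by rewrite sumn_cat sumn_map_succ sa; lia.
  - rewrite -ltnNge nth_cat size_map sa ifF; last by lia.
    case: (ltnP (t - r - j) (size b)) => ib; last by rewrite nth_default //; lia.
    by have /= := tb _ (mem_nth 0 ib); lia.
  - rewrite !filter_cat count_cat filter_map_succ; last by apply/allP.
    have e0 : [seq y <- b | t < y] = [::].
      apply/eqP; rewrite -[_ == _]negbK -has_filter; apply/hasPn => y /tb /=; lia.
    have e1 : [seq y <- [seq z.+1 | z <- a] | y <= t] = [::].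
      apply/eqP; rewrite -[_ == _]negbK -has_filter.
      by apply/hasPn => _ /mapP[z /at_ zt ->] /=; lia.
    have e2 : [seq y <- b | y <= t] = b by apply/all_filterP/allP.
    rewrite e0 e1 e2 cats0 /= -!size_filter e0 filter_map_succ; last by apply/allP.
    by rewrite size_map sa addn0 -map_comp map_id.
move=> /= -[j s] /mem_marked_partitionsP[/= ps s0 sN].
rewrite /crank_region /= addnS ltnNge negbK => h.
rewrite /f /g /=; have := cat_filter_geq (j + r) ps; set t := j + r in h *.
(* Outside the smaller region at most [j] parts exceed [t = j + r], so the new mark is at most [j]
   and the inserted [t] satisfies [crank_region r]. *)
have cj : count (leq t.+1) s <= j.
  by rewrite leqNgt ltn_count_nth ?pairwise_geq // -leqNgt.
have := size_filter (leq t.+1) s.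
set a := filter (leq t.+1) s; set b := [seq y <- s | y <= t] => sa es.
have a0 x : x \in a -> t < x by rewrite mem_filter => /andP[].
have bt x : x \in b -> x <= t by rewrite mem_filter => /andP[].
move: (ps) s0 sN; rewrite -{1 2 3}es pairwise_cat all_cat sumn_cat.
move=> /and3P[_ pa pb] /andP[a1 b1] sN; split.
- apply/mem_marked_partitionsP; split=> /=.
  + rewrite pairwise_cat pairwise_map /= pb andbT; apply/and3P; split.
    * apply/allrelP => _ y /mapP[x /a0 xt ->]; rewrite inE => /predU1P[->|/bt] /=; lia.
    * by apply: sub_pairwise pa => x y /=; lia.
    * by apply/allP => x /bt.
  + rewrite all_cat /= b1 andbT; apply/andP; split; last by lia.
    by apply/allP => _ /mapP[x /a0 xt ->]; lia.
  + rewrite sumn_cat /= sumn_map_pred // sa; have := size_le_sumn a1; rewrite sa.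
    by move: (count _ s) cj; lia.
- by rewrite nth_cat size_map sa ltnn subnn /=; lia.
- rewrite nth_cat size_map sa ltnn subnn /= addnK; congr pair.
  rewrite -sa -(size_map predn) take_size_cat // drop_cat size_map ltnNge leqnSn /=.
  rewrite subSn // subnn /= drop0 -map_comp map_id_in // => x /a0 /=; lia.
Qed.

Definition crank_ge r N :=
  count (fun s => (r%:Z <= crank s)%R) (partitions N).

(** The form that [crank_region r] takes once the pairs with nonzero mark are conjugated: at least
    [j + r] parts exceed [j]. With the mark read as the number of ones, this is the definition of
    crank at least [r], in both of its cases. *)
Definition ones_region r (x : nat * seq nat) :=
  if x.1 == 0 then r <= head 0 x.2 else x.1 < nth 0 x.2 (x.1 + r).-1.

Lemma mem_marked_partitions_conj N j (s : seq nat) :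
  (j, s) \in marked_partitions N ->
  s \in partitions (N - j) /\ (j, conj_part s) \in marked_partitions N.
Proof.
move=> /mem_marked_partitionsP[/= ps s0 sN].
have sp : s \in partitions (N - j) by apply/mem_partitionsP; split=> //; lia.
split=> //; have /mem_partitionsP[pc c0 cN] := conj_part_partition sp.
by apply/mem_marked_partitionsP; split=> //=; lia.
Qed.

Lemma marked_ge_ones r N : 0 < r ->
  marked_ge r N = count (ones_region r) (marked_partitions N).
Proof.
move=> r0; pose f (x : nat * seq nat) :=
  (x.1, if x.1 == 0 then x.2 else conj_part x.2).
have key (j : nat) (s : seq nat) : (j, s) \in marked_partitions N ->
    [/\ f (j, s) \in marked_partitions N, f (f (j, s)) = (j, s),
        crank_region r (j, s) -> ones_region r (f (j, s))
      & ones_region r (j, s) -> crank_region r (f (j, s))].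
  move=> h; have [sp hc] := mem_marked_partitions_conj h.
  have /mem_partitionsP[ps _ _] := sp.
  rewrite /f /crank_region /ones_region /=; case: eqP h hc => [->|/eqP j0] h hc /=.
    by split=> //; rewrite nth0 add0n.
  rewrite ?(negPf j0) (conj_partK sp) !nth_conj_part //; split=> //.
    by rewrite ltn_count_nth ?pairwise_geq // prednK //; lia.
  by rewrite -ltn_count_nth ?pairwise_geq //; move: (count _ s); lia.
apply: (@count_bij _ _ _ _ _ _ f f); rewrite ?uniq_marked_partitions //.
  by move=> [j s] /key[? ? ? ?] ?; split=> //; auto.
by move=> [j s] /key[? ? ? ?] ?; split=> //; auto.
Qed.

Lemma partition_rcons_one (s : seq nat) : pairwise geq s -> all (leq 1) s ->
  1 \in s -> s = rcons (take (size s).-1 s) 1.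
Proof.
case/lastP: s => [|s x] //; rewrite pairwise_rcons => /andP[/allP sx _].
rewrite all_rcons => /andP[x0 _]; rewrite mem_rcons inE size_rcons /= => h.
have -> : x = 1.
  by case/predU1P: h => [//|/sx /=]; lia.
by rewrite -[in take _ _]cats1 take_size_cat.
Qed.

(** This is the factor 1 - q. Pairs whose partition has a part 1 come from total [N.-1] by appending
    that part; in the others the mark [j] is turned into [j] ones, which gives the partitions of [N]
    of crank at least [r]. *)
Lemma crank_ge_marked r N : 0 < r -> 1 < N ->
  crank_ge r N + marked_ge r N.-1 = marked_ge r N.
Proof.
move=> r0 N1; rewrite !marked_ge_ones //.
have -> : count (ones_region r) (marked_partitions N) =
  count (predI (ones_region r) (fun x => 1 \notin x.2)) (marked_partitions N) +
  count (predI (ones_region r) (fun x => 1 \in x.2)) (marked_partitions N).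
  elim: (marked_partitions N) => //= x s ->.
  by case: (ones_region r x); case: (1 \in x.2) => /=; lia.
congr addn.
  pose f (s : seq nat) := (ones s, [seq x <- s | 1 < x]).
  pose g (x : nat * seq nat) := x.2 ++ nseq x.1 1.
  apply: (@count_bij _ _ _ _ _ _ f g); rewrite ?uniq_marked_partitions
    ?uniq_partitions //.
    move=> /= s /mem_partitionsP[ps s0 sN] h.
    have eo : [seq x <- s | x <= 1] = nseq (ones s) 1.
      rewrite filter_ones //; congr nseq; rewrite /ones.
      elim: s s0 {ps sN h} => //= x s IH /andP[x0 /IH].
      by have := count_size (leq 2) s; case: (ltngtP x 1) x0; lia.
    have es := cat_filter_geq 1 ps; rewrite eo in es.
    have pf : pairwise geq [seq x <- s | 1 < x] by exact: pairwise_filter.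
    split; last by rewrite /g /=.
    - apply/mem_marked_partitionsP; split=> //=.
        by apply/allP => x; rewrite mem_filter => /andP[/ltnW].
      by rewrite addnC -[in RHS]sN -[in RHS]es sumn_cat sumn_nseq mul1n.
    - rewrite /= mem_filter /= andbT /ones_region /=; move: h; rewrite /crank.
      rewrite largest_part_head //.
      case: eqP => [o0|/eqP o0 h].
        by move: es; rewrite o0 /= cats0 => ->; rewrite lez_nat.
      rewrite -ltn_count_nth ?pairwise_geq // count_filter.
      rewrite (_ : count _ s = mu s).
        by move: h; move: (mu s) (ones s) o0; lia.
      by apply: eq_count => x /=; move: o0; lia.
  move=> /= -[j s] /mem_marked_partitionsP[/= ps s0 sN].
  rewrite /ones_region /= => /andP[h s1].
  have s2 : all (leq 2) s.
    apply/allP => x xs; move/allP: s0 => /(_ x xs).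
    by case: (ltngtP x 1) => // x1; move: s1; rewrite -x1 xs.
  have og : ones (s ++ nseq j 1) = j.
    by rewrite /ones count_cat count_nseq /= mul1n (count_memPn s1).
  have pg : pairwise geq (s ++ nseq j 1).
    rewrite pairwise_cat ps /=; apply/andP; split.
      by apply/allrelP => x y xs /nseqP[-> _]; move/allP: s0; apply.
    by elim: (j) => //= n ->; rewrite all_nseq orbT.
  rewrite /g /=; split.
  - apply/mem_partitionsP; split=> //.
      by rewrite all_cat s0 all_nseq orbT.
    by rewrite sumn_cat sumn_nseq; lia.
  - rewrite /crank og largest_part_head //; case: eqP h => [->|/eqP j0] h.
      by rewrite cats0 lez_nat.
    have -> : mu (s ++ nseq j 1) = count (leq j.+1) s.
      rewrite /mu og count_cat count_nseq ltnNge (_ : 1 <= j) ?addn0 //.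
      by rewrite lt0n.
    by move: h; rewrite -ltn_count_nth ?pairwise_geq //; move: (count _ s); lia.
  - have e0 : [seq x <- nseq j 1 | 1 < x] = [::] by elim: (j).
    by rewrite /f og filter_cat (all_filterP s2) e0 cats0.
pose f (x : nat * seq nat) := (x.1, rcons x.2 1).
pose g (x : nat * seq nat) := (x.1, take (size x.2).-1 x.2).
(* An extra part 1 does not exceed a mark [j > 0]. For [j = 0] it alters the largest part only of
   the empty partition, which [1 < N] excludes; this is where [N = 1] behaves differently. *)
have reg (j : nat) (s : seq nat) : (j, s) \in marked_partitions N.-1 ->
    ones_region r (j, rcons s 1) = ones_region r (j, s).
  move=> /mem_marked_partitionsP[/= _ _ sN].
  rewrite /ones_region /=; case: eqP sN => [->|/eqP j0] sN.
    by case: s sN => //=; lia.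
  rewrite nth_rcons; case: (ltngtP (j + r).-1 (size s)) => // e.
    by rewrite nth_default // ltnW.
  by rewrite nth_default ?e // !ltnS ltn0 leqn0 (negPf j0).
have memf (j : nat) (s : seq nat) : (j, s) \in marked_partitions N.-1 <->
    (j, rcons s 1) \in marked_partitions N.
  split=> /mem_marked_partitionsP[/= + + sN].
    move=> ps s0; apply/mem_marked_partitionsP; split=> /=.
    - by rewrite pairwise_rcons ps andbT.
    - by rewrite all_rcons.
    - by rewrite sumn_rcons; lia.
  rewrite pairwise_rcons all_rcons => /andP[_ ps] /= s0.
  apply/mem_marked_partitionsP; split=> //=.
  by move: sN; rewrite sumn_rcons; lia.
apply: (@count_bij _ _ _ _ _ _ f g); rewrite ?uniq_marked_partitions //.
  move=> /= -[j s] js h; rewrite /f /g /=; split; first exact/memf.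
    by rewrite reg // h mem_rcons mem_head.
  by rewrite size_rcons /= -cats1 take_size_cat.
move=> /= -[j s] js /andP[h s1]; rewrite /f /g /=.
have /mem_marked_partitionsP[/= ps s0 _] := js.
have es := partition_rcons_one ps s0 s1; rewrite /= in s1 h.
have jt : (j, take (size s).-1 s) \in marked_partitions N.-1.
  by apply/memf; rewrite -es.
by split=> //; [rewrite -(reg _ _ jt) -es | rewrite -es].
Qed.

(** * The parity of ospt *)

(** The value p(N - e), with 0 for [e > N], where truncated subtraction would give p(0). *)
Definition shifted_count N e := if e <= N then size (partitions (N - e)) else 0.

Lemma shifted_countD N a e : a <= N ->
  shifted_count N (a + e) = shifted_count (N - a) e.
Proof.
move=> aN; rewrite /shifted_count (_ : (a + e <= N) = (e <= N - a)); last by lia.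
by rewrite subnDA.
Qed.

Lemma odd_sum (I : Type) (s : seq I) (P : pred I) (F : I -> nat) :
  odd (\sum_(i <- s | P i) F i) = \big[addb/false]_(i <- s | P i) odd (F i).
Proof. exact: (big_morph odd oddD). Qed.

Lemma eq_odd_sum (I : eqType) (s : seq I) (P : pred I) (F G : I -> nat) :
  (forall i, i \in s -> P i -> odd (F i) = odd (G i)) ->
  odd (\sum_(i <- s | P i) F i) = odd (\sum_(i <- s | P i) G i).
Proof.
move=> FG; rewrite !odd_sum big_seq_cond [RHS]big_seq_cond.
by apply: eq_bigr => i /andP[]; exact: FG.
Qed.

(** Iterating [rank_ge_rec] gives an alternating sum in which [r] grows by 3 at each step; the signs
    vanish modulo 2. The terms with [n > N] are 0, so any bound [K >= N] will do. *)
Lemma odd_rank_ge K r N : 0 < r + N -> N <= K ->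
  odd (rank_ge r N) =
  odd (\sum_(1 <= n < K.+1) shifted_count N (3 * 'C(n, 2) + n * r.+1)).
Proof.
elim: K r N => [|K IH] r N rN NK.
  by rewrite big_nil rank_ge_small //; lia.
rewrite big_nat_recl // bin_small // muln0 add0n mul1n.
case: (ltnP r N) => [ltrN|leNr]; last first.
  rewrite rank_ge_small //; last by lia.
  rewrite {1}/shifted_count ifF; last by lia.
  rewrite big_nat big1 // => n nK; rewrite /shifted_count ifF //.
  by apply/negbTE; rewrite -ltnNge; nia.
have /(congr1 odd) := rank_ge_rec ltrN; rewrite oddD => e.
rewrite oddD {1}/shifted_count ltrN -e (IH (r + 3)) -?addbA; [|lia|lia].
rewrite -[LHS]addbF; congr addb; rewrite -oddD -[RHS]/(odd _).
rewrite (eq_big_nat _ _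
  (F2 := fun n => shifted_count N (3 * 'C(n.+1, 2) + n.+1 * r.+1))).
  by rewrite addnn odd_double.
move=> n _; rewrite -shifted_countD //; congr shifted_count.
by rewrite binS bin1; lia.
Qed.

(* Modulo 2, the number of partitions of [N] of crank at least [r], with the
   right convention for [N = 1]. *)
Definition marked_diff r N :=
  marked_ge r N + (if N is M.+1 then marked_ge r M else 0).

(** The difference of [marked_ge_rec] at [N] and at [N - 1], by [size_marked_partitions]; the case
    [r = N] is separate, since the second recurrence is then out of range. *)
Lemma odd_marked_diff_rec r N : 0 < r -> r <= N ->
  odd (marked_diff r N + marked_diff r.+1 (N - r)) = odd (size (partitions (N - r))).
Proof.
move=> r0 rN; have e1 := marked_ge_rec r0 rN; rewrite /marked_diff.
case: N rN e1 => [|N] rN e1; first by lia.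
case: (ltnP N r) => Nr.
  have r1 : N.+1 - r = 0 by lia.
  rewrite r1 in e1 *; rewrite (marked_ge_small (N := 0)) // in e1 *.
  rewrite (marked_ge_small r0 Nr) !addn0 -[marked_ge r _]addn0 e1.
  by rewrite /marked_partitions size_allpairs_dep /= addn0.
have e2 := marked_ge_rec r0 Nr.
rewrite subSn // in e1 *; have := size_marked_partitions (N - r).
by lia.
Qed.

Lemma odd_marked_diff K r N : 0 < r -> N <= K ->
  odd (marked_diff r N) =
  odd (\sum_(1 <= n < K.+1) shifted_count N ('C(n, 2) + n * r)).
Proof.
elim: K r N => [|K IH] r N r0 NK.
  rewrite big_nil /marked_diff marked_ge_small //; last by lia.
  by case: N NK.
rewrite big_nat_recl // bin_small // add0n mul1n.
case: (leqP r N) => [lerN|ltNr]; last first.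
  rewrite /marked_diff marked_ge_small //.
  rewrite {1}/shifted_count ifF; last by lia.
  rewrite big_nat big1 => [|n nK]; last first.
    by rewrite /shifted_count ifF //; apply/negbTE; rewrite -ltnNge; nia.
  by case: N ltNr {NK} => // N ltNr; rewrite marked_ge_small //; lia.
have := odd_marked_diff_rec r0 lerN; rewrite oddD => e.
rewrite oddD {1}/shifted_count lerN -e (IH r.+1) -?addbA; [|lia|lia].
rewrite -[LHS]addbF; congr addb; rewrite -oddD.
rewrite (eq_big_nat _ _ (F2 := fun n => shifted_count N ('C(n.+1, 2) + n.+1 * r))).
  by rewrite addnn odd_double.
move=> n _; rewrite -shifted_countD //; congr shifted_count.
by rewrite binS bin1; lia.
Qed.

(** Both sides add up the positive parts of the values of [c] over [s]. *)
Lemma sum_mul_count (T : eqType) (s : seq T) (c : T -> int) N :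
  (forall x, x \in s -> (c x <= N%:Z)%R) ->
  \sum_(1 <= m < N.+1) m * count (fun x => c x == Posz m) s =
  \sum_(1 <= m < N.+1) count (fun x => (m%:Z <= c x)%R) s.
Proof.
elim: s => [|x s IH] /= cN; first by rewrite !big1 // => m _; rewrite muln0.
under eq_bigr do rewrite mulnDr; rewrite !big_split /= IH; last first.
  by move=> y ys; apply: cN; rewrite inE ys orbT.
congr addn; have := cN x (mem_head _ _); case: (c x) => k kN; last first.
  by rewrite !big1 // => m _; rewrite ?muln0.
have e1 M : \sum_(1 <= m < M.+1) m * (Posz k == Posz m) = (k <= M) * k.
  elim: M => [|M IHM]; first by rewrite big_nil; case: (k).
  rewrite big_nat_recr //= IHM eqz_nat.
  by case: (ltngtP k M.+1) => kM; case: (leqP k M) => kM'; lia.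
have e2 M : \sum_(1 <= m < M.+1) (m%:Z <= Posz k)%R = minn M k.
  elim: M => [|M IHM]; first by rewrite big_nil min0n.
  by rewrite big_nat_recr //= IHM lez_nat; case: leqP => kM /=; lia.
by rewrite e1 e2; lia.
Qed.

Lemma rank_countE m N :
  rank_count m N = Posz (count (fun s => rank s == m) (partitions N)).
Proof. by rewrite -count_partitions. Qed.

Lemma crank_countE m N : N != 1 ->
  crank_count m N = Posz (count (fun s => crank s == m) (partitions N)).
Proof. by move=> /negPf N1; rewrite /crank_count N1 -count_partitions. Qed.

Lemma rank_moment_sum N :
  rank_moment N = Posz (\sum_(1 <= r < N.+1) rank_ge r N).
Proof.
rewrite /rank_moment; under [LHS]eq_bigr do rewrite rank_countE -PoszM.
rewrite -(big_morph Posz PoszD (erefl _)) sum_mul_count.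
  congr Posz; apply: eq_bigr => r _; apply: eq_in_count => s.
  by move=> /mem_partitionsP[ps _ _]; rewrite /rank largest_part_head //; lia.
move=> s; rewrite mem_partitions => /largest_part_leq; rewrite /rank; lia.
Qed.

Lemma crank_moment_sum N : N != 1 ->
  crank_moment N = (\sum_(1 <= r < N.+1) crank_ge r N)%:Z%R.
Proof.
move=> N1; rewrite /crank_moment; under [LHS]eq_bigr do rewrite crank_countE // -PoszM.
rewrite -(big_morph Posz PoszD (erefl _)) sum_mul_count // => s.
rewrite mem_partitions => sN; have := largest_part_leq sN; have := mu_leq sN.
rewrite /crank; case: ifP => _; lia.
Qed.

Lemma partitions0 : partitions 0 = [:: [::]].
Proof.
apply: perm_small_eq => //; apply: uniq_perm (uniq_partitions 0) _ _ => // s.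
rewrite inE; apply/mem_partitionsP/eqP => [[_ s0 sN]|-> //].
by have := size_le_sumn s0; rewrite sN; case: s {s0 sN}.
Qed.

Lemma bin2_double n : 'C(n, 2) * 2 + n = n * n.
Proof. by elim: n => // n IH; rewrite binS bin1; lia. Qed.

(** The rank exponent [3 * 'C(n, 2) + n * r.+1] equals ['C(n, 2) + n * (n + r)]. The rank terms thus
    repeat the crank terms with index above [n], and only the indices up to [n] survive modulo 2. *)
Lemma odd_ospt N : 0 < N ->
  odd `|ospt N| =
  odd (\sum_(1 <= n < N.+1) \sum_(1 <= r < n.+1) shifted_count N ('C(n, 2) + n * r)).
Proof.
move=> N0; rewrite /ospt rank_moment_sum.
have -> : odd `|(crank_moment N - Posz (\sum_(1 <= r < N.+1) rank_ge r N))%R| =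
   odd (\sum_(1 <= r < N.+1) (marked_diff r N + rank_ge r N)).
  (* For [N = 1] the convention gives crank moment 1, which is also the value of
     [marked_diff 1 1]. *)
  rewrite big_split /=; case: (eqVneq N 1) => [->|N1].
    have -> : crank_moment 1 = 1%R by rewrite /crank_moment big_nat1.
    have -> : \sum_(1 <= r < 2) marked_diff r 1 = 1.
      rewrite big_nat1 /marked_diff [marked_ge 1 0]marked_ge_small // addn0.
      have := marked_ge_rec (leqnn 1) (leqnn 1).
      rewrite subnn [marked_ge 2 0]marked_ge_small // addn0 => ->.
      by rewrite size_allpairs_dep /= partitions0.
    lia.
  rewrite crank_moment_sum // [in RHS](eq_big_nat _ _
    (F2 := fun r => crank_ge r N + 2 * marked_ge r N.-1)); last first.
    move=> r /andP[r0 _]; rewrite /marked_diff -crank_ge_marked //; last by lia.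
    by case: (N) N0 => //= M _; lia.
  by rewrite big_split /= -big_distrr /=; lia.
rewrite (eq_odd_sum (G := fun r => \sum_(1 <= n < N.+1)
    (shifted_count N ('C(n, 2) + n * r) +
     shifted_count N ('C(n, 2) + n * (n + r))))); last first.
  move=> r; rewrite mem_index_iota => /andP[r0 rN] _.
  rewrite oddD (odd_marked_diff r0 (leqnn N)) (odd_rank_ge _ (leqnn N)) ?addn_gt0 ?r0 //.
  rewrite -oddD -big_split /=; congr odd; apply: eq_bigr => n _; congr addn.
  by congr shifted_count; have := bin2_double n; lia.
rewrite exchange_big /=; apply: eq_odd_sum => n; rewrite mem_index_iota => /andP[n0 nN] _.
pose h r := shifted_count N ('C(n, 2) + n * r).
have h0 a : N < a -> h a = 0.
  by move=> Na; rewrite /h /shifted_count ifF //; apply/negbTE; rewrite -ltnNge; nia.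
rewrite big_split /= -/(h _) (big_cat_nat _ (n := n.+1)) //= -addnA oddD -[RHS]addbF.
congr addb.
have -> : \sum_(1 <= r < N.+1) shifted_count N ('C(n, 2) + n * (n + r)) =
          \sum_(n.+1 <= r < N.+1) h r.
  have e : \sum_(1 + n <= r < N.+1 + n) h r = \sum_(n.+1 <= r < N.+1) h r.
    rewrite (big_cat_nat _ (n := N.+1)) //=; last by lia.
    rewrite [X in _ + X]big_nat_cond [X in _ + X]big1 ?addn0 // => r.
    by rewrite andbT => /andP[Nr _]; exact: h0.
  by rewrite -e big_addn addnK; apply: eq_bigr => r _; rewrite /h [r + n]addnC.
by rewrite addnn odd_double.
Qed.

(** * The pentagonal number theorem *)

Definition unit6 c := (c %% 6 == 1) || (c %% 6 == 5).

(** For [c = 6 n - 1] and [c = 6 n + 1] these are the generalised pentagonal numbers n (3 n - 1) / 2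
    and n (3 n + 1) / 2. *)
Definition pentagonal c := (c ^ 2 - 1) %/ 24.

Lemma pentagonalE c : unit6 c -> pentagonal c * 24 + 1 = c ^ 2.
Proof.
move=> c6; have [q e] : exists q, c ^ 2 = q * 24 + 1.
  have [m [cm|cm]] : exists m, c = 12 * m + 1 \/
      c = 12 * m + 5 \/ c = 12 * m + 7 \/ c = 12 * m + 11.
    by exists (c %/ 12); move: c6; rewrite /unit6; lia.
  by exists (6 * m * m + m); rewrite cm expnS expn1; lia.
  case: cm => [cm|[cm|cm]].
  - by exists (6 * m * m + 5 * m + 1); rewrite cm expnS expn1; lia.
  - by exists (6 * m * m + 7 * m + 2); rewrite cm expnS expn1; lia.
  - by exists (6 * m * m + 11 * m + 5); rewrite cm expnS expn1; lia.
by rewrite /pentagonal e addnK mulnK.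
Qed.

Lemma sum_unit6 K (F : nat -> nat) :
  \sum_(c <- iota 1 (6 * K + 1) | unit6 c) F c =
  F 1 + \sum_(1 <= n < K.+1) (F (6 * n - 1) + F (6 * n + 1)).
Proof.
elim: K => [|K IH]; first by rewrite big_nil /= big_cons big_nil.
rewrite big_nat_recr // addnA -IH (_ : 6 * K.+1 + 1 = 6 * K + 1 + 6); last by lia.
rewrite (iotaD 1 (6 * K + 1) 6) big_cat; congr addn.
have -> : 6 * K.+1 - 1 = 6 * K + 5 by lia.
have -> : 6 * K + 1 + 6 = 6 * K + 7 by lia.
have -> : 1 + (6 * K + 1) = 6 * K + 2 by lia.
have u i : unit6 (6 * K + i) = unit6 i by rewrite /unit6 mulnC modnMDl.
by rewrite /= -!addnS !big_cons big_nil !u /= addn0.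
Qed.

(** Euler's recurrence modulo 2: expanding both terms of [rank_ge01] by [odd_rank_ge] produces the
    two families of pentagonal exponents. *)
Lemma pentagonal_recurrence K N : N <= K ->
  odd (\sum_(c <- iota 1 (6 * K + 1) | unit6 c) shifted_count N (pentagonal c))
  = (N == 0).
Proof.
move=> NK; rewrite sum_unit6.
rewrite (eq_big_nat _ _ (F2 := fun n => shifted_count N (3 * 'C(n, 2) + n * 1) +
    shifted_count N (3 * 'C(n, 2) + n * 2))); last first.
  move=> n /andP[n0 _]; have b := bin2_double n.
  congr (shifted_count N _ + shifted_count N _).
    have h : unit6 (6 * n - 1) by rewrite /unit6; lia.
    by have := pentagonalE h; rewrite expnS expn1; nia.
  have h : unit6 (6 * n + 1) by rewrite /unit6; lia.
  by have := pentagonalE h; rewrite expnS expn1; nia.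
rewrite {1}/shifted_count /= subn0; case: (posnP N) => [->|N0].
  rewrite partitions0 big_nat big1 // => n /andP[n0 _].
  by rewrite /shifted_count !leqn0 !addn_eq0 !muln_eq0 /= !ifF //; lia.
rewrite big_split !oddD /= -(odd_rank_ge (r := 0)) // -(odd_rank_ge (r := 1)) //.
by rewrite -rank_ge01 oddD addbb; lia.
Qed.

(** * Reduction to the ternary equation *)

Definition grid B := [seq (x, y) | x <- iota 1 B, y <- iota 1 B].

Definition cube B := [seq (x, y) | x <- iota 1 B, y <- grid B].

Lemma uniq_grid B : uniq (grid B).
Proof. by apply: allpairs_uniq; rewrite ?iota_uniq // => -[? ?] [? ?] _ _. Qed.

Lemma uniq_cube B : uniq (cube B).
Proof.
by apply: allpairs_uniq; rewrite ?iota_uniq ?uniq_grid // => -[? ?] [? ?] _ _.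
Qed.

Lemma mem_grid B x : (x \in grid B) = (0 < x.1 <= B) && (0 < x.2 <= B).
Proof.
case: x => x y; apply/allpairsP/idP => [[[a b] /= []]|/= h].
  by rewrite !mem_iota => + + [-> ->]; lia.
by exists (x, y); rewrite !mem_iota; split=> //=; lia.
Qed.

Lemma mem_cube B x : (x \in cube B) = (0 < x.1 <= B) && (x.2 \in grid B).
Proof.
case: x => x y; apply/allpairsP/idP => [[[a b] /= []]|/= /andP[h yB]].
  by rewrite mem_iota => + + [-> ->] => + -> /=; lia.
by exists (x, y); rewrite mem_iota; split=> //=; lia.
Qed.

(** [E] is the sum of the n consecutive integers r, ..., r + n - 1, with r at most n; the count is
    the D E of the overview. *)
Definition staircase E (x : nat * nat) :=
  (x.2 <= x.1) && ('C(x.1, 2) + x.1 * x.2 == E).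

(* With [a = 12 k - w] these are the factorisations [24 t - 1 = a b], [a < b]. *)
Definition factorisation t (x : nat * nat) :=
  (x.2 < 12 * x.1) && (144 * x.1 ^ 2 + 1 == x.2 ^ 2 + 24 * t).

Definition ternary E (x : nat * (nat * nat)) :=
  [&& unit6 x.1, x.2.2 < 12 * x.2.1 &
      144 * x.2.1 ^ 2 + x.1 ^ 2 == x.2.2 ^ 2 + 24 * E].

Lemma odd_ospt_staircase N : 0 < N ->
  odd `|ospt N| =
  odd (\sum_(0 <= E < N.+1) size (partitions (N - E)) * count (staircase E) (grid N)).
Proof.
move=> N0; rewrite odd_ospt //; congr odd.
transitivity (\sum_(x <- grid N | x.2 <= x.1)
  shifted_count N ('C(x.1, 2) + x.1 * x.2)).
  have eL : iota 1 N = index_iota 1 N.+1 by rewrite /index_iota subn1.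
  rewrite [RHS]big_mkcond big_allpairs eL; apply: eq_big_nat => n /andP[n0 nN].
  by rewrite -big_mkcond (big_nat_widen _ _ N.+1) //; lia.
under [RHS]eq_bigr do rewrite -sum1_count big_distrr /= big_mkcond.
rewrite exchange_big /= big_mkcond; apply: eq_bigr => x _.
rewrite /staircase; case: (x.2 <= x.1) => /=; last by rewrite big1.
rewrite -big_mkcond /=; under [RHS]eq_bigl do rewrite eq_sym.
by rewrite big_nat1_eq muln1 /shifted_count ltnS.
Qed.

(** As [c ^ 2 = 24 * pentagonal c + 1], the ternary solutions with a given [c] are the
    factorisations of [24 * (E - pentagonal c) - 1]; [w < 12 k] leaves none when
    [pentagonal c > E]. *)
Lemma sum_count_factorisation B E :
  \sum_(c <- iota 1 B | unit6 c)
    (if pentagonal c <= E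
     then count (factorisation (E - pentagonal c)) (grid B) else 0) =
  count (ternary E) (cube B).
Proof.
rewrite -sum1_count [RHS]big_mkcond big_allpairs [LHS]big_mkcond; apply: eq_bigr => c _.
rewrite /ternary /=; case c6: (unit6 c) => /=; last by rewrite big1.
have e := pentagonalE c6; rewrite -big_mkcond sum1_count; case: leqP => cE.
  apply: eq_count => -[k w] /=; rewrite /factorisation /=; congr andb.
  by apply/eqP/eqP; lia.
apply/esym/eqP; rewrite eqn0Ngt -has_count; apply/hasPn => -[k w] _ /=.
apply/negP => /andP[wk /eqP]; have : w ^ 2 < (12 * k) ^ 2 by rewrite ltn_exp2r.
by rewrite expnMn; lia.
Qed.

(** Let P, Q and T be the generating functions of p, of the pentagonal exponents and of the
    factorisation counts. Modulo 2, [key] makes the staircase series equal to Q T up to degree [N],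
    and P Q = 1, so P Q T = T. *)
Lemma odd_ospt_factorisation N : 0 < N ->
  (forall E, E <= N ->
     odd (count (staircase E) (grid N)) =
     odd (count (ternary E) (cube (24 * N + 1)))) ->
  odd `|ospt N| = odd (count (factorisation N) (grid (24 * N + 1))).
Proof.
move=> N0 key; rewrite odd_ospt_staircase //.
set B := 24 * N + 1 in key *; set L := iota 1 B.
pose T t := count (factorisation t) (grid B).
transitivity (odd (\sum_(0 <= E < N.+1) \sum_(c <- L | unit6 c && (pentagonal c <= E))
    size (partitions (N - E)) * T (E - pentagonal c))).
  apply: eq_odd_sum => E; rewrite mem_index_iota => EN _.
  rewrite -big_distrr !oddM key //= -sum_count_factorisation big_mkcondr /=.
  by congr (_ && odd _).
transitivity (odd (\sum_(0 <= t < N.+1) T t *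
    \sum_(c <- L | unit6 c) shifted_count (N - t) (pentagonal c))); last first.
  have rec M : M <= N ->
      odd (\sum_(c <- L | unit6 c) shifted_count M (pentagonal c)) = (M == 0).
    (* The range of [c] was chosen of length [6 * K + 1] with [K = 4 * N]. *)
    by move=> MN; rewrite /L /B (_ : 24 * N = 6 * (4 * N)) ?pentagonal_recurrence; lia.
  rewrite big_nat_recr //= oddD oddM rec ?leq_subr // subnn andbT.
  rewrite odd_sum big_nat_cond big1 // => t /andP[/andP[_ tN] _].
  by rewrite oddM rec ?leq_subr // subn_eq0 leqNgt tN andbF.
congr odd; rewrite (exchange_big_dep unit6) /=; last by move=> E c _ /andP[].
under [RHS]eq_bigr do rewrite big_distrr.
rewrite [RHS]exchange_big /=; apply: eq_bigr => c c6.
case: (leqP (pentagonal c) N) => cN; last first.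
  rewrite big_nat_cond big1 => [|E]; last by lia.
  rewrite big1 // => t _; rewrite /shifted_count ifF ?muln0 //; lia.
rewrite (big_cat_nat _ (n := pentagonal c)) //=; last by lia.
rewrite [X in X + _]big_nat_cond [X in X + _]big1 ?add0n => [|E]; last by lia.
rewrite [RHS](big_cat_nat _ (n := N.+1 - pentagonal c)) //=; last by lia.
rewrite [X in _ = _ + X]big_nat_cond [X in _ = _ + X]big1 => [|t]; last first.
  by move=> ?; rewrite /shifted_count ifF ?muln0 //; lia.
rewrite addn0 -{1}[pentagonal c]add0n big_addn.
rewrite big_nat_cond [RHS]big_nat_cond; apply: eq_big => [t|t]; first by lia.
move=> /andP[/andP[_ tN] _]; rewrite addnK mulnC /shifted_count ifT; last by lia.
by rewrite subnDA.
Qed.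

(** * Binary quadratic forms *)

Local Open Scope ring_scope.

Definition int_range (B : nat) : seq int :=
  [seq i%:Z - B%:Z | i <- iota 0 (2 * B + 1)].

Lemma mem_int_range B (x : int) : (x \in int_range B) = (- B%:Z <= x <= B%:Z).
Proof.
apply/mapP/idP => [[i]|xB]; first by rewrite mem_iota => iB ->; lia.
by exists (absz (x + B%:Z)); rewrite ?mem_iota; lia.
Qed.

Definition int_cube (B : nat) : seq (int * (int * int)) :=
  [seq (p, y) | p <- int_range B,
                y <- [seq (k, r) | k <- int_range B, r <- int_range B]].

Lemma mem_int_cube B (p k r : int) :
  ((p, (k, r)) \in int_cube B) =
  [&& - B%:Z <= p <= B%:Z, - B%:Z <= k <= B%:Z & - B%:Z <= r <= B%:Z].
Proof.
apply/allpairsP/and3P => [[[p' y] /= []]|[hp hk hr]].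
  by move=> + /allpairsP[[k' r'] /= []] + + -> [-> -> ->]; rewrite !mem_int_range.
exists (p, (k, r)); split=> //=; first by rewrite mem_int_range.
by apply/allpairsP; exists (k, r); rewrite !mem_int_range.
Qed.

Lemma uniq_int_cube B : uniq (int_cube B).
Proof.
have u : uniq (int_range B) by rewrite map_inj_uniq ?iota_uniq // => i j; lia.
by do 2![apply: allpairs_uniq; rewrite ?u //; last by move=> [? ?] [? ?] _ _].
Qed.

(* The triple [(p, (k, r))] stands for the binary quadratic form
   [3 p Y^2 - 12 k Y - r] of discriminant [24 E]; its values at 1 and -1 are
   [at1] and [atN1]. *)
Definition is_form (E : nat) (x : int * (int * int)) : bool :=
  let: (p, (k, r)) := x in
  [&& 12 * k * k + p * r == 2 * E%:Z, ((p + r) %% 2)%Z == 1 & (r %% 3)%Z != 0].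

Definition at1 (x : int * (int * int)) : int :=
  let: (p, (k, r)) := x in 3 * p - r - 12 * k.

Definition atN1 (x : int * (int * int)) : int :=
  let: (p, (k, r)) := x in 3 * p - r + 12 * k.

(** The box makes the list finite. The three [forms_separating] lemmas show that it holds every form
    separating two vertices of the triangle 0, 1, oo with the chosen sign, so the reflections do not
    leave it. *)
Definition forms (E : nat) : seq (int * (int * int)) :=
  [seq x <- int_cube (100 * E) | is_form E x].

Lemma uniq_forms E : uniq (forms E).
Proof. by rewrite filter_uniq ?uniq_int_cube. Qed.

Lemma mem_forms E p k r : (p, (k, r)) \in forms E ->
  [/\ 12 * k * k + p * r = 2 * E%:Z, ((p + r) %% 2)%Z = 1 & (r %% 3)%Z != 0].
Proof. by rewrite mem_filter => /andP[/and3P[/eqP ? /eqP ? ?] _]. Qed.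

Lemma mulr_self_ge0 (x : int) : 0 <= x * x.
Proof. by rewrite -expr2 sqr_ge0. Qed.

Lemma mulr_self_bound (x b : int) : x * x <= b -> - b <= x <= b.
Proof. by case: (ltrgt0P x) => x0 h; nia. Qed.

(** The discriminant [24 * E] is a square plus 4 times the product of the positive numbers [- r] and
    [- at1], which bounds every coefficient. The next two lemmas use the analogous identities for
    the other two sides. *)
Lemma forms_separating01 E p k r : is_form E (p, (k, r)) ->
  r < 0 -> at1 (p, (k, r)) < 0 -> (p, (k, r)) \in forms E.
Proof.
move=> f r0 f1; rewrite mem_filter f mem_int_cube; case/and3P: f => /eqP h _ _.
have e : (12 * k + 2 * r) * (12 * k + 2 * r) +
    4 * (- r * (12 * k + r - 3 * p)) = 12 * (12 * k * k + p * r) by ring.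
rewrite h in e; move: f1; rewrite /at1 => f1.
have e0 := mulr_self_ge0 (12 * k + 2 * r).
have [b eb] : exists b, b = 12 * k + r - 3 * p by eexists.
have [a ea] : exists a, a = 12 * k + 2 * r by eexists.
rewrite -eb -ea in e e0 *.
have b1 : 1 <= b by lia.
(* Positive integers satisfy x + y - 1 <= x y, so a bound on the product bounds both. *)
have h1 : 0 <= (- r - 1) * (b - 1) by apply: mulr_ge0; lia.
have h2 : - r + b - 1 <= 6 * E%:Z by lia.
have h0 : 0 <= - r * b by apply: mulr_ge0; lia.
have h3 : a * a <= 24 * E%:Z by lia.
have h4 := mulr_self_bound h3.
lia.
Qed.

Lemma forms_separating0oo E p k r : is_form E (p, (k, r)) ->
  r < 0 -> p < 0 -> (p, (k, r)) \in forms E.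
Proof.
move=> f r0 f1; rewrite mem_filter f mem_int_cube; case/and3P: f => /eqP h _ _.
have h1 : 0 <= (- r - 1) * (- p - 1) by apply: mulr_ge0; lia.
have h2 := mulr_self_ge0 k.
have h3 : - r - p - 1 <= 2 * E%:Z by lia.
have h0 : 0 <= - r * - p by apply: mulr_ge0; lia.
have h5 : k * k <= 2 * E%:Z by lia.
have h4 := mulr_self_bound h5.
lia.
Qed.

Lemma forms_separating1oo E p k r : is_form E (p, (k, r)) ->
  0 < p -> at1 (p, (k, r)) < 0 -> (p, (k, r)) \in forms E.
Proof.
move=> f p0 f1; rewrite mem_filter f mem_int_cube; case/and3P: f => /eqP h _ _.
move: f1; rewrite /at1 => f1.
have e : 3 * ((2 * k - p) * (2 * k - p)) + p * (12 * k + r - 3 * p) =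
    12 * k * k + p * r by ring.
rewrite h in e.
have e0 := mulr_self_ge0 (2 * k - p).
have [b eb] : exists b, b = 12 * k + r - 3 * p by eexists.
have [a ea] : exists a, a = 2 * k - p by eexists.
rewrite -eb -ea in e e0 *.
have h1 : 0 <= (p - 1) * (b - 1) by apply: mulr_ge0; lia.
have h2 : p + b - 1 <= 2 * E%:Z by lia.
have h0 : 0 <= p * b by apply: mulr_ge0; lia.
have h3 : a * a <= 2 * E%:Z by lia.
have h4 := mulr_self_bound h3.
lia.
Qed.

(* The sign of a form is normalised so that its value [- r] at 0, or at oo in
   [sep1oo], is positive; [p = 0] means that oo is an end of the geodesic. *)
Definition sep01 (x : int * (int * int)) := (x.2.2 < 0) && (at1 x < 0).

Definition sepN11 (x : int * (int * int)) := sep01 x && (0 < atN1 x).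

Definition sep0oo (x : int * (int * int)) := (x.2.2 < 0) && (x.1 < 0).

Definition sep1oo (x : int * (int * int)) := (0 < x.1) && (at1 x < 0).

(** The [axis_] predicates describe forms fixed by a reflection: [k = 0] for Y -> - Y and [p = 2 k]
    for Y -> 2 - Y. When [k = 0], the sign of the common value [3 p - r] at 1 and -1 splits
    [axis_sep0oo] into [axis_sepN10] and [axis_rest]. *)
Definition axis_sep0oo (x : int * (int * int)) :=
  [&& x.2.1 == 0, x.2.2 < 0 & x.1 < 0].

Definition axis_sepN10 (x : int * (int * int)) :=
  [&& x.2.1 == 0, x.2.2 < 0 & 3 * x.1 < x.2.2].

Definition axis_rest (x : int * (int * int)) :=
  [&& x.2.1 == 0, x.2.2 < 0, x.1 < 0 & x.2.2 < 3 * x.1].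

Definition axis_sep1oo (x : int * (int * int)) :=
  [&& x.1 == 2 * x.2.1, 0 < x.1 & 0 < 6 * x.2.1 + x.2.2].

(* A form separating 0 from 1 but not -1 from 1 separates -1 from 0 as well:
   a set stable under [Y -> - Y]. *)
Lemma odd_sep01_sepN11 E :
  odd (count sep01 (forms E)) =
  odd (count sepN11 (forms E)) (+)
  odd (count axis_sepN10 (forms E)).
Proof.
rewrite (odd_count_split _ _ (fun x => 0 < atN1 x)); congr addb.
rewrite (@odd_count_invol _ _ _ (fun x => (x.1, (- x.2.1, x.2.2)))) ?uniq_forms //.
  congr odd; apply: eq_in_count => -[p [k r]] /mem_forms[h h2 h3].
  by rewrite /axis_sepN10 /sep01 /= /at1 /atN1 /= !xpair_eqE !eqxx /=; lia.
move=> [p [k r]] xE; have [h h2 h3] := mem_forms xE.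
(* The reflection swaps [at1] and [atN1]. As 3 does not divide [r], [atN1] is nonzero, hence
   negative here. *)
rewrite /= /sep01 /at1 /atN1 /= => /andP[/andP[r0 f1] fN1].
split; last by rewrite opprK.
  apply: forms_separating01 => //; last by rewrite /at1; lia.
  by rewrite /is_form -h; apply/and3P; split=> //; lia.
lia.
Qed.

Lemma odd_sep0oo E :
  odd (count sep0oo (forms E)) =
  odd (count axis_sep0oo (forms E)).
Proof.
rewrite (@odd_count_invol _ _ _ (fun x => (x.1, (- x.2.1, x.2.2)))) ?uniq_forms //.
  congr odd; apply: eq_in_count => -[p [k r]] /mem_forms[h h2 h3].
  by rewrite /axis_sep0oo /sep0oo /= !xpair_eqE !eqxx /=; lia.
move=> [p [k r]] xE; have [h h2 h3] := mem_forms xE.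
rewrite /= /sep0oo /= => /andP[r0 p0]; split; [|lia|by rewrite opprK].
apply: forms_separating0oo => //.
by rewrite /is_form -h; apply/and3P; split=> //; lia.
Qed.

(* The reflection is [Y -> 2 - Y]. *)
Lemma odd_sep1oo E :
  odd (count sep1oo (forms E)) =
  odd (count axis_sep1oo (forms E)).
Proof.
rewrite (@odd_count_invol _ _ _ (fun x =>
  (x.1, (x.1 - x.2.1, x.2.2 + 24 * x.2.1 - 12 * x.1)))) ?uniq_forms //.
  congr odd; apply: eq_in_count => -[p [k r]] /mem_forms[h h2 h3].
  by rewrite /axis_sep1oo /sep1oo /= /at1 !xpair_eqE !eqxx /=; lia.
move=> [p [k r]] xE; have [h h2 h3] := mem_forms xE.
rewrite /= /sep1oo /at1 /= => /andP[p0 f1]; split; [|lia|].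
  apply: forms_separating1oo => //; last by rewrite /at1; lia.
  rewrite /is_form -h; apply/and3P; split; [|lia|lia].
  by apply/eqP; ring.
by congr (_, (_, _)); lia.
Qed.

(** For [p = 0] the form is linear, and Y -> 1 - Y followed by a change of sign is an involution. A
    fixed form would have [r = - 6 k], divisible by 3. *)
Lemma odd_sep01_parabolic E :
  odd (count (fun x => sep01 x && (x.1 == 0)) (forms E)) = false.
Proof.
rewrite (@odd_count_invol _ _ _ (fun x =>
  (x.1, (x.2.1, - (12 * x.2.1) - x.2.2)))) ?uniq_forms //.
  rewrite (eq_in_count (a2 := pred0)) ?count_pred0 // => -[p [k r]] /mem_forms[h h2 h3].
  by rewrite /sep01 /= /at1 !xpair_eqE !eqxx /=; lia.
move=> [p [k r]] xE; have [h h2 h3] := mem_forms xE.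
rewrite /= /sep01 /at1 /= => /andP[/andP[r0 f1] /eqP p0]; split.
- apply: forms_separating01; [|lia|by rewrite /at1; lia].
  by rewrite /is_form -h p0; apply/and3P; split; lia.
- lia.
- by congr (_, (_, _)); lia.
Qed.

(* The sides of the ideal triangle 0, 1, oo; the form [x] and [opp x] define the
   same geodesic. *)
Lemma odd_sep01_sep0oo_sep1oo E :
  odd (count sep01 (forms E)) =
  odd (count sep0oo (forms E)) (+) odd (count sep1oo (forms E)).
Proof.
rewrite (odd_count_split _ _ (fun x => x.1 == 0)) odd_sep01_parabolic addFb.
rewrite (odd_count_split _ _ (fun x => x.1 < 0)).
rewrite (odd_count_split _ sep0oo (fun x => at1 x < 0)).
rewrite (odd_count_split _ sep1oo (fun x => x.2.2 < 0)).
pose opp (x : int * (int * int)) := (- x.1, (- x.2.1, - x.2.2)).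
have oppK x : opp (opp x) = x by case: x => p [k r]; rewrite /opp /= !opprK.
(* Geodesics separating oo from both 0 and 1 occur in both sums, with opposite signs of the form,
   and cancel. The others cross the side from 0 to 1. *)
have -> : count (predI sep0oo (predC (fun x => at1 x < 0))) (forms E) =
          count (predI sep1oo (predC (fun x => x.2.2 < 0))) (forms E).
  apply: (@count_bij _ _ _ _ _ _ opp opp); rewrite ?uniq_forms //.
    move=> [p [k r]] xE; have [h h2 h3] := mem_forms xE.
    rewrite oppK /opp /= /sep0oo /sep1oo /at1 /= => c; split=> //.
      apply: forms_separating1oo; [|lia|by rewrite /at1; lia].
      rewrite /is_form -h; apply/and3P; split; [|lia|lia].
      by apply/eqP; ring.
    lia.
  move=> [p [k r]] xE; have [h h2 h3] := mem_forms xE.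
  rewrite oppK /opp /= /sep0oo /sep1oo /at1 /= => c; split=> //.
    apply: forms_separating0oo; [|lia|lia].
    rewrite /is_form -h; apply/and3P; split; [|lia|lia].
    by apply/eqP; ring.
  lia.
rewrite addbACA addbb addbF; congr (odd _ (+) odd _).
  apply: eq_count => -[p [k r]]; rewrite /sep01 /sep0oo /sep1oo /at1 /=; lia.
apply: eq_count => -[p [k r]]; rewrite /sep01 /sep0oo /sep1oo /at1 /=; lia.
Qed.

Local Close Scope ring_scope.

(** * Separating forms as solutions of the ternary equation *)

Lemma sqr_unit6 w q : w * w = 12 * q + 1 -> unit6 w.
Proof.
move=> e; have ew := divn_eq w 6; have := ltn_pmod w (isT : 0 < 6).
rewrite /unit6; set a := w %/ 6 in ew; set b := w %% 6 in ew *.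
have e2 : w * w = 12 * (3 * a * a + a * b) + b * b by rewrite ew; ring.
move: e2; rewrite e; case: b {ew} => [|[|[|[|[|[|b]]]]]] //; lia.
Qed.

(** With c = |r + 3 p| and w = |r - 3 p| one has 12 p r = c ^ 2 - w ^ 2, so 12 times the equation of
    the form is the ternary one; [at1 < 0 < atN1] means [w < 12 k]. *)
Lemma count_sepN11 B E : 24 * E <= B ->
  count sepN11 (forms E) = count (ternary E) (cube B).
Proof.
move=> EB; pose f (x : int * (int * int)) : nat * (nat * nat) :=
  (absz (x.2.2 + 3 * x.1)%R, (absz x.2.1, absz (x.2.2 - 3 * x.1)%R)).
(* Since [r < 0], at most one of r + 3 p and r - 3 p is positive, and then it is the smaller in
   absolute value. Both are negative exactly when [c] and [w] agree modulo 6. *)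
pose g (x : nat * (nat * nat)) : int * (int * int) :=
  let c := x.1 in let k := x.2.1 in let w := x.2.2 in
  if c %% 6 == w %% 6 then (((w%:Z - c%:Z) %/ 6)%Z, (k%:Z, (- (c%:Z + w%:Z) %/ 2)%Z))%R
  else if c < w then (((c%:Z + w%:Z) %/ 6)%Z, (k%:Z, ((c%:Z - w%:Z) %/ 2)%Z))%R
  else ((- (c%:Z + w%:Z) %/ 6)%Z, (k%:Z, ((w%:Z - c%:Z) %/ 2)%Z))%R.
apply: (@count_bij _ _ _ _ _ _ f g); rewrite ?uniq_forms ?uniq_cube //.
  move=> [p [k r]] xE; have [h h2 h3] := mem_forms xE.
  rewrite /= /sepN11 /sep01 /at1 /atN1 /= => /andP[/andP[r0 f1] fN1].
  have [c ec] : exists c : nat, c = absz (r + 3 * p)%R by eexists.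
  have [w ew] : exists w : nat, w = absz (r - 3 * p)%R by eexists.
  have [m em] : exists m : nat, m = absz k by eexists.
  have ek : k = m%:Z%R by lia.
  have cw : 144 * (m * m) + c * c = w * w + 24 * E.
    have e1 : (c%:Z * c%:Z = (r + 3 * p) * (r + 3 * p))%R by rewrite ec; lia.
    have e2 : (w%:Z * w%:Z = (r - 3 * p) * (r - 3 * p))%R by rewrite ew; lia.
    subst k; lia.
  rewrite /f /= -ec -ew -em; split.
  - rewrite mem_cube mem_grid /=.
    have c0 : 0 < c by lia.
    have w0 : 0 < w by lia.
    have m0 : 0 < m by lia.
    have wm : w < 12 * m by lia.
    (* The equation becomes c ^ 2 + 2 w d + d ^ 2 = 24 E, which bounds [c], [w] and [m] by [B]. *)
    have [d ed d0] : exists2 d, 12 * m = w + d & 0 < d by exists (12 * m - w); lia.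
    have h5 : c <= c * c by rewrite leq_pmulr.
    have h6 : 144 * (m * m) = w * w + 2 * (w * d) + d * d.
      have -> : 144 * (m * m) = (12 * m) * (12 * m) by lia.
      by rewrite ed; lia.
    have h7 : w <= w * d by rewrite leq_pmulr.
    have h8 : d <= d * d by rewrite leq_pmulr.
    lia.
  - rewrite /ternary /= -!mulnn cw eqxx andbT; apply/andP; split; last by lia.
    by rewrite /unit6; lia.
  - rewrite /g /= -ek; case: eqP => [e6|/eqP e6].
      by congr (_, (_, _)); lia.
    by case: ltnP => cltw; congr (_, (_, _)); lia.
move=> [c [k w]]; rewrite mem_cube mem_grid /ternary /= => b /and3P[c6 wk].
rewrite -!mulnn => /eqP e; have := pentagonalE c6; rewrite -mulnn => ec.
have w6 : unit6 w.
  apply: (@sqr_unit6 w (12 * (k * k) + 2 * pentagonal c - 2 * E)); lia.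
have [p [r [eg erp]]] : exists p r : int, g (c, (k, w)) = (p, (k%:Z, r))%R /\
    [\/ [/\ c%:Z = - (r + 3 * p), w%:Z = - (r - 3 * p) & r < 0],
        [/\ c%:Z = - (r + 3 * p), w%:Z = r - 3 * p & r < 0] |
        [/\ c%:Z = r + 3 * p, w%:Z = - (r - 3 * p) & r < 0]]%R.
  rewrite /g /=; move: c6 w6; rewrite /unit6 => c6 w6; case: eqP => [e6|/eqP e6].
    by do 2!eexists; split; [reflexivity|apply: Or31; split; lia].
  case: ltnP => cltw; do 2!eexists; (split; first by reflexivity).
    by apply: Or33; split; lia.
  by apply: Or32; split; lia.
have r0 : (r < 0)%R by case: erp => -[].
have h : (12 * k%:Z * k%:Z + p * r = 2 * E%:Z)%R.
  have e1 : (c%:Z * c%:Z = (r + 3 * p) * (r + 3 * p))%R.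
    by case: erp => -[-> _ _]; lia.
  have e2 : (w%:Z * w%:Z = (r - 3 * p) * (r - 3 * p))%R.
    by case: erp => -[_ -> _]; lia.
  have e3 : (144 * (k%:Z * k%:Z) + c%:Z * c%:Z = w%:Z * w%:Z + 24 * E%:Z)%R by lia.
  by move: e3; rewrite e1 e2; lia.
have f1 : (3 * p - r - 12 * k%:Z < 0)%R by case: erp => -[]; lia.
have fN1 : (0 < 3 * p - r + 12 * k%:Z)%R by case: erp => -[]; lia.
rewrite eg; split.
- apply: forms_separating01 => //; rewrite /is_form h eqxx /=.
  by move: c6; rewrite /unit6; case: erp => -[]; lia.
- by rewrite /sepN11 /sep01 /at1 /atN1 /= r0 f1 fN1.
- by rewrite /f /=; congr (_, (_, _)); case: erp => -[]; lia.
Qed.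

(** * Factorisations *)

Definition odd_divisor E (x : nat * nat) := odd x.1 && (x.1 * x.2 == E).

(** Twice [E] is the product of n and n - 1 + 2 r, which have opposite parity: d is the odd one and
    2 k the even one. The condition 1 <= r <= n says that n is the smaller factor and the larger is
    below 3 n. *)
Lemma count_staircase M E : E <= M ->
  count (staircase E) (grid M) =
  count (fun x => [&& odd_divisor E x, x.1 < 6 * x.2 & 2 * x.2 < 3 * x.1]) (grid M).
Proof.
move=> EM.
pose f (x : nat * nat) :=
  if odd x.1 then (x.1, (x.1 - 1 + 2 * x.2) %/ 2) else (x.1 - 1 + 2 * x.2, x.1 %/ 2).
pose g (x : nat * nat) :=
  if 2 * x.2 < x.1 then (2 * x.2, (x.1 + 1 - 2 * x.2) %/ 2)
  else (x.1, (2 * x.2 + 1 - x.1) %/ 2).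
apply: (@count_bij _ _ _ _ _ _ f g); rewrite ?uniq_grid //.
  move=> [n r]; rewrite mem_grid /staircase /= => b /andP[rn /eqP e].
  have h := bin2_double n.
  have h2 : n * (n - 1 + 2 * r) = 2 * E by nia.
  rewrite /f /g /=; case on: (odd n) => /=.
    have [k ek] : exists k, n - 1 + 2 * r = 2 * k by exists ((n - 1 + 2 * r) %/ 2); lia.
    have -> : (n - 1 + 2 * r) %/ 2 = k by lia.
    have nk : n * k = E by move: h2; rewrite ek; lia.
    have kM : k <= n * k by rewrite leq_pmull //; lia.
    rewrite mem_grid /odd_divisor /= on nk eqxx /= ifF; last by lia.
    split; [lia|lia|congr pair; lia].
  have [k ek] : exists k, n = 2 * k by exists (n %/ 2); lia.
  have -> : n %/ 2 = k by lia.
  set d := n - 1 + 2 * r in h2 *.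
  have nk : d * k = E by move: h2; rewrite ek; lia.
  have d0 : 0 < d by lia.
  have k0 : 0 < k by lia.
  have kM : k <= d * k by rewrite leq_pmull.
  have dM : d <= d * k by rewrite leq_pmulr.
  rewrite mem_grid /odd_divisor /= nk eqxx andbT ifT; last by lia.
  split; [lia|lia|congr pair; lia].
move=> [d k]; rewrite mem_grid /odd_divisor /= => b /andP[/andP[od /eqP e] c].
rewrite /f /g /=; case: ltnP => kd /=.
  have h := bin2_double (2 * k).
  have [r er] : exists r, d + 1 - 2 * k = 2 * r by exists ((d + 1 - 2 * k) %/ 2); lia.
  have -> : (d + 1 - 2 * k) %/ 2 = r by lia.
  rewrite mul2n odd_double -mul2n mem_grid /staircase /=.
  have ed : d = 2 * r + 2 * k - 1 by lia.
  have e2 : (2 * r + 2 * k) * k = E + k by rewrite -e ed mulnBl mul1n; nia.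
  have dE : d <= d * k by rewrite leq_pmulr; lia.
  split; [lia| |congr pair; lia].
  by apply/andP; split; [lia|apply/eqP; lia].
have h := bin2_double d.
have [r er] : exists r, 2 * k + 1 - d = 2 * r by exists ((2 * k + 1 - d) %/ 2); lia.
have -> : (2 * k + 1 - d) %/ 2 = r by lia.
rewrite od mem_grid /staircase /=.
have ek : 2 * k + 1 = 2 * r + d by lia.
have e2 : d * (2 * k + 1) = d * (2 * r + d) by rewrite ek.
split; [lia| |congr pair; lia].
apply/andP; split; [lia|apply/eqP; lia].
Qed.

Lemma mem_grid_divisor M E (d k : nat) :
  E <= M -> 0 < d -> 0 < k -> d * k = E -> (d, k) \in grid M.
Proof.
move=> EM d0 k0 e; move: EM; rewrite -e mem_grid /=.
have : d <= d * k by rewrite leq_pmulr.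
have : k <= d * k by rewrite leq_pmull.
lia.
Qed.

(** For [k = 0] the equation is p r = 2 E with exactly one of [p], [r] even. Halving that one
    factors [E] with an odd factor, and the two cases give the two counts. *)
Lemma count_axis_rest M E : E <= M ->
  count axis_rest (forms E) =
  count (fun x => [&& odd_divisor E x, ~~ (3 %| x.1) & 6 * x.2 < x.1]) (grid M) +
  count (fun x => [&& odd_divisor E x, ~~ (3 %| x.2) & 3 * x.1 < 2 * x.2]) (grid M).
Proof.
move=> EM; have -> : count axis_rest (forms E) =
    count (predI axis_rest (fun x => (x.1 %% 2)%Z == 0%R)) (forms E) +
    count (predI axis_rest (fun x => (x.1 %% 2)%Z != 0%R)) (forms E).
  elim: (forms E) => //= x s ->.
  by case: (axis_rest x); case: (_ == _) => /=; lia.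
congr addn.
  pose f (x : int * (int * int)) := (absz x.2.2, absz x.1 %/ 2).
  pose g (x : nat * nat) : int * (int * int) := (- (2 * x.2%:Z), (0, - x.1%:Z))%R.
  apply: (@count_bij _ _ _ _ _ _ f g); rewrite ?uniq_forms ?uniq_grid //.
    move=> [p [k r]] xE; have [h h2 h3] := mem_forms xE.
    rewrite /axis_rest /f /g /= => c; have k0 : k = 0%R by lia.
    have [a ea] : exists a : nat, p = (- (2 * a%:Z))%R by exists (absz p %/ 2); lia.
    have [d ed] : exists d : nat, r = (- d%:Z)%R by exists (absz r); lia.
    move: c h h2 h3; rewrite {}k0 {}ea {}ed {xE} => c h h2 h3.
    have -> : absz (- d%:Z)%R = d by lia.
    have -> : absz (- (2 * a%:Z))%R %/ 2 = a by lia.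
    have e : d * a = E by lia.
    split; [apply: mem_grid_divisor e; lia| |by congr (_, (_, _)); lia].
    by rewrite /odd_divisor /= e eqxx; lia.
  move=> [d a]; rewrite mem_grid /odd_divisor /axis_rest /f /g /= => b c.
  have e : d * a = E by lia.
  split; [|lia|by congr (_, _); lia].
  apply: forms_separating0oo; [|lia|lia].
  by rewrite /is_form -e; apply/and3P; split; lia.
pose f (x : int * (int * int)) := (absz x.1, absz x.2.2 %/ 2).
pose g (x : nat * nat) : int * (int * int) := (- x.1%:Z, (0, - (2 * x.2%:Z)))%R.
apply: (@count_bij _ _ _ _ _ _ f g); rewrite ?uniq_forms ?uniq_grid //.
  move=> [p [k r]] xE; have [h h2 h3] := mem_forms xE.
  rewrite /axis_rest /f /g /= => c; have k0 : k = 0%R by lia.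
  have [a ea] : exists a : nat, r = (- (2 * a%:Z))%R by exists (absz r %/ 2); lia.
  have [d ed] : exists d : nat, p = (- d%:Z)%R by exists (absz p); lia.
  move: c h h2 h3; rewrite {}k0 {}ea {}ed {xE} => c h h2 h3.
  have -> : absz (- d%:Z)%R = d by lia.
  have -> : absz (- (2 * a%:Z))%R %/ 2 = a by lia.
  have e : d * a = E by lia.
  split; [apply: mem_grid_divisor e; lia| |by congr (_, (_, _)); lia].
  by rewrite /odd_divisor /= e eqxx; lia.
move=> [d a]; rewrite mem_grid /odd_divisor /axis_rest /f /g /= => b c.
have e : d * a = E by lia.
split; [|lia|by congr (_, _); lia].
apply: forms_separating0oo; [|lia|lia].
by rewrite /is_form -e; apply/and3P; split; lia.
Qed.

(** For [p = 2 k] the equation becomes k (6 k + r) = E, and d = 6 k + r is odd and prime to 3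
    because [r] is. *)
Lemma count_axis_sep1oo M E : E <= M ->
  count axis_sep1oo (forms E) =
  count (fun x => odd_divisor E x && ~~ (3 %| x.1)) (grid M).
Proof.
move=> EM; pose f (x : int * (int * int)) := (absz (6 * x.2.1 + x.2.2)%R, absz x.2.1).
pose g (x : nat * nat) : int * (int * int) :=
  (2 * x.2%:Z, (x.2%:Z, x.1%:Z - 6 * x.2%:Z))%R.
apply: (@count_bij _ _ _ _ _ _ f g); rewrite ?uniq_forms ?uniq_grid //.
  move=> [p [k r]] xE; have [h h2 h3] := mem_forms xE.
  rewrite /axis_sep1oo /f /g /= => c.
  have [a ea] : exists a : nat, k = a%:Z%R by exists (absz k); lia.
  have [d ed] : exists d : nat, r = (d%:Z - 6 * a%:Z)%R.
    by exists (absz (6 * k + r)%R); lia.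
  have ep : p = (2 * a%:Z)%R by lia.
  move: c h h2 h3; rewrite {}ep {}ea {}ed {xE} => c h h2 h3.
  have -> : absz (6 * a%:Z + (d%:Z - 6 * a%:Z))%R = d by lia.
  have e : d * a = E by lia.
  split; [apply: mem_grid_divisor e; lia| |by congr (_, (_, _)); lia].
  by rewrite /odd_divisor /= e eqxx; lia.
move=> [d a]; rewrite mem_grid /odd_divisor /axis_sep1oo /f /g /= => b c.
have e : d * a = E by lia.
split; [|lia|by congr (_, _); lia].
apply: forms_separating1oo; [|lia|by rewrite /at1; lia].
by rewrite /is_form -e; apply/and3P; split; lia.
Qed.

Lemma count_split (T : eqType) (s : seq T) (P P1 P2 : pred T) :
  {in s, forall x, P x = P1 x || P2 x} -> (forall x, ~~ (P1 x && P2 x)) ->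
  count P s = count P1 s + count P2 s.
Proof.
move=> e d; rewrite -count_predUI (eq_count (a2 := pred0) (a1 := predI P1 P2)).
  by rewrite count_pred0 addn0; apply: eq_in_count.
by move=> x; apply/negbTE/d.
Qed.

(** A factor 3 moves from the odd divisor to its cofactor. *)
Lemma count_divisor_triple M E : E <= M ->
  count (fun x => [&& odd_divisor E x, 3 %| x.1 & x.1 < 6 * x.2]) (grid M) =
  count (fun x => [&& odd_divisor E x, 3 %| x.2 & 3 * x.1 < 2 * x.2]) (grid M).
Proof.
move=> EM; pose f (x : nat * nat) := (x.1 %/ 3, 3 * x.2).
pose g (x : nat * nat) := (3 * x.1, x.2 %/ 3).
apply: (@count_bij _ _ _ _ _ _ f g); rewrite ?uniq_grid //.
  move=> [d k]; rewrite mem_grid /odd_divisor /f /g /= => b c.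
  have [q eq] : exists q, d = 3 * q by exists (d %/ 3); lia.
  move: b c; rewrite {}eq => b c; have -> : 3 * q %/ 3 = q by lia.
  have e : q * (3 * k) = E by lia.
  split; [apply: mem_grid_divisor e; lia| |by congr (_, _); lia].
  by rewrite e eqxx; lia.
move=> [d k]; rewrite mem_grid /odd_divisor /f /g /= => b c.
have [q eq] : exists q, k = 3 * q by exists (k %/ 3); lia.
move: b c; rewrite {}eq => b c; have -> : 3 * q %/ 3 = q by lia.
have e : 3 * d * q = E by lia.
split; [apply: mem_grid_divisor e; lia| |by congr (_, _); lia].
by rewrite e eqxx; lia.
Qed.

(** Modulo 2 [axis_sepN10] occurs twice and cancels, so the separating forms reduce to [axis_rest]
    and [axis_sep1oo]. By [e1] to [e4] and [count_divisor_triple] these add up to the divisor count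
    of [count_staircase]; d = 6 k and 3 d = 2 k are impossible for odd d. *)
Lemma odd_staircase_ternary M B E : E <= M -> 24 * E <= B ->
  odd (count (staircase E) (grid M)) = odd (count (ternary E) (cube B)).
Proof.
move=> EM EB; rewrite -count_sepN11 // count_staircase //.
have := odd_sep01_sepN11 E; rewrite odd_sep01_sep0oo_sep1oo odd_sep0oo odd_sep1oo.
rewrite (count_axis_sep1oo EM).
rewrite (count_split _ (P := axis_sep0oo) (P1 := axis_sepN10)
  (P2 := axis_rest)); last 2 first.
- move=> [p [k r]] /mem_forms[_ _].
  by rewrite /axis_sep0oo /axis_sepN10 /axis_rest /=; lia.
- by move=> x; rewrite /axis_sepN10 /axis_rest; lia.
rewrite (count_axis_rest EM).
set G := grid M; pose od := odd_divisor E.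
have e1 : count (fun x => od x && ~~ (3 %| x.1)) G =
    count (fun x => [&& od x, ~~ (3 %| x.1) & 6 * x.2 < x.1]) G +
    count (fun x => [&& od x, ~~ (3 %| x.1) & x.1 < 6 * x.2]) G.
  by apply: count_split => -[d k] *; rewrite /od /odd_divisor /=; lia.
have e2 : count (fun x => od x && (x.1 < 6 * x.2)) G =
    count (fun x => [&& od x, ~~ (3 %| x.1) & x.1 < 6 * x.2]) G +
    count (fun x => [&& od x, 3 %| x.1 & x.1 < 6 * x.2]) G.
  by apply: count_split => -[d k] *; rewrite /od /odd_divisor /=; lia.
have e3 : count (fun x => od x && (3 * x.1 < 2 * x.2)) G =
    count (fun x => [&& od x, ~~ (3 %| x.2) & 3 * x.1 < 2 * x.2]) G +
    count (fun x => [&& od x, 3 %| x.2 & 3 * x.1 < 2 * x.2]) G.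
  by apply: count_split => -[d k] *; rewrite /od /odd_divisor /=; lia.
have e4 : count (fun x => od x && (x.1 < 6 * x.2)) G =
    count (fun x => [&& od x, x.1 < 6 * x.2 & 2 * x.2 < 3 * x.1]) G +
    count (fun x => od x && (3 * x.1 < 2 * x.2)) G.
  by apply: count_split => -[d k] *; rewrite /od /odd_divisor /=; lia.
move: (congr1 odd e1) (congr1 odd e2) (congr1 odd e3) (congr1 odd e4).
rewrite -(count_divisor_triple EM) -/od -/G !oddD => -> -> ->.
by do ![case: (odd _) => //].
Qed.

(** * Divisors of 24 N - 1 *)

Lemma size_divisors_coprime p e m : prime p -> 0 < m -> coprime p m ->
  size (divisors (p ^ e * m)) = e.+1 * size (divisors m).
Proof.
move=> pp m0 pm; have p0 := prime_gt0 pp.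
transitivity (size [seq p ^ i * d | i <- iota 0 e.+1, d <- divisors m]); last first.
  by rewrite size_allpairs size_iota.
have log_pd i d : d %| m -> logn p (p ^ i * d) = i.
  move=> dm; have d0 := dvdn_gt0 m0 dm.
  by rewrite lognM ?expn_gt0 ?p0 // pfactorK // logn_coprime ?addn0 // (coprime_dvdr dm).
apply/perm_size/uniq_perm; first exact: divisors_uniq.
  apply: allpairs_uniq; rewrite ?iota_uniq ?divisors_uniq // => -[i d] [j c].
  move=> h1 h2 /= e1.
  have [[i' d'] /= [_ hd [_ ed]]] := allpairsP h1.
  have [[j' c'] /= [_ hc [_ ec]]] := allpairsP h2.
  move: hd hc; rewrite -ed -ec -!dvdn_divisors // => hd hc.
  have eij : i = j by rewrite -(log_pd i d hd) e1 log_pd.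
  by move: e1; rewrite eij => /eqP; rewrite eqn_pmul2l ?expn_gt0 ?p0 // => /eqP ->.
move=> x; rewrite -dvdn_divisors ?muln_gt0 ?expn_gt0 ?p0 //.
apply/idP/allpairsP => [xn|[[i d] /= [hi]]].
  have x0 : 0 < x by apply: dvdn_gt0 xn; rewrite muln_gt0 expn_gt0 p0.
  have [y py ex] := pfactor_coprime pp x0.
  exists (logn p x, y); rewrite mulnC -ex; split=> //.
    have := dvdn_leq_log p _ xn; rewrite log_pd // muln_gt0 expn_gt0 p0.
    by rewrite (mem_iota 0 e.+1) /=; apply.
  rewrite -dvdn_divisors //; move: xn; rewrite {1}ex => /(dvdn_trans (dvdn_mulr _ (dvdnn y))).
  by rewrite Gauss_dvdr // coprime_sym coprimeXl.
rewrite -dvdn_divisors // => dm ->; apply: dvdn_mul => //.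
by apply: dvdn_exp2l; move: hi; rewrite (mem_iota 0 e.+1).
Qed.

Lemma odd_size_divisors n : 0 < n ->
  odd (size (divisors n)) = odd (count (fun d => d * d == n) (divisors n)).
Proof.
move=> n0; rewrite -count_predT (@odd_count_invol _ _ _ (fun d => n %/ d)) ?divisors_uniq //.
  congr odd; apply: eq_in_count => d; rewrite -dvdn_divisors // => dn /=.
  have d0 := dvdn_gt0 n0 dn.
  apply/eqP/eqP => [e|<-]; last by rewrite mulnK.
  by have := divnK dn; rewrite e.
move=> d; rewrite -!dvdn_divisors // => dn _.
have [q eq] := dvdnP dn; have d0 := dvdn_gt0 n0 dn.
have q0 : 0 < q by case: q eq n0 => // ->.
by rewrite eq mulnK // mulKn // dvdn_mulr.
Qed.

Lemma odd_size_divisors_sqr m : 0 < m -> odd (size (divisors (m ^ 2))).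
Proof.
move=> m0; have n0 : 0 < m ^ 2 by rewrite expn_gt0 m0.
rewrite odd_size_divisors //.
rewrite (eq_count (a2 := pred1 m)) => [|d /=].
  by rewrite count_uniq_mem ?divisors_uniq // -dvdn_divisors // dvdn_exp.
by rewrite mulnn eqn_exp2r.
Qed.

Lemma sqr_of_odd_size_divisors n : 0 < n -> odd (size (divisors n)) ->
  exists2 m, 0 < m & n = m ^ 2.
Proof.
move=> n0; rewrite odd_size_divisors // => h.
have : has (fun d => d * d == n) (divisors n) by rewrite has_count odd_gt0.
case/hasP => d dn /eqP e; exists d; last by rewrite -mulnn.
by move: dn; rewrite -dvdn_divisors // => /(dvdn_gt0 n0).
Qed.

(** The number of divisors is the product of e + 1 over the prime exponents e. It is 2 modulo 4
    exactly when a single e is odd and that one is 1 modulo 4. *)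
Lemma size_divisors_mod4 n : 0 < n ->
  size (divisors n) %% 4 = 2 <->
  exists l a m, [/\ prime l, 0 < m, coprime l m & n = l ^ (4 * a + 1) * m ^ 2].
Proof.
move=> n0; split=> [|[l [a [m [lp m0 lm ->]]]]]; last first.
  have c : coprime l (m ^ 2) by rewrite coprimeXr.
  rewrite size_divisors_coprime ?expn_gt0 ?m0 //.
  have := odd_size_divisors_sqr m0; move: (size _) => d od.
  have -> : d = d %/ 2 * 2 + 1 by lia.
  lia.
have [k] := ubnP n; elim: k n n0 => // k IH n n0 nk.
case: (ltngtP n 1) => [|n1|->]; [by lia| |by []].
(* The smallest prime is split off. If its exponent is odd it is [l], and the cofactor is a square;
   otherwise its power goes into [m] and the cofactor is treated by induction. *)
have pp := pdiv_prime n1; set p := pdiv n in pp.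
have [m pm en] := pfactor_coprime pp n0.
have m0 : 0 < m by case: m en {pm} n0 => // ->.
set e := logn p n in en.
have e0 : 0 < e by rewrite /e logn_gt0 mem_primes pp n0 pdiv_dvd.
rewrite {1}en mulnC size_divisors_coprime //.
set d := size _ => h; case oe: (odd e).
  have ed : e = 4 * (e %/ 4) + 1 /\ odd d.
    have [q eq] : exists q, e = 2 * q + 1 by exists (e %/ 2); lia.
    have h2 : (q.+1 * d) %% 2 = 1 by move: h; rewrite eq; lia.
    have : odd (q.+1 * d) by lia.
    by rewrite oddM => /andP[oq od]; lia.
  have [s s0 es] := sqr_of_odd_size_divisors m0 (proj2 ed).
  exists p, (e %/ 4), s; split=> //; last by rewrite -(proj1 ed) -es mulnC.
  by move: pm; rewrite es coprime_pexpr.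
have [||l [a [s [lp s0 ls es]]]] := IH m m0.
- apply: leq_ltn_trans (_ : n.-1 < k); last by lia.
  suff : m < n by lia.
  rewrite en -{1}[m]muln1 ltn_pmul2l //; apply: leq_trans (prime_gt1 pp) _.
  by rewrite -{1}[p]expn1 leq_exp2l // prime_gt1.
- have [q eq] : exists q, e = 2 * q by exists (e %/ 2); lia.
  rewrite -/d; move: h; rewrite eq.
  have : odd ((2 * q).+1 * d) = odd d by rewrite oddM /= oddM.
  case od: (odd d) => h2; first by lia.
  have [u eu] : exists u, d = 2 * u by exists (d %/ 2); lia.
  have : odd ((2 * q).+1 * u) = odd u by rewrite oddM /= oddM.
  by rewrite eu mulnCA; lia.
exists l, a, (s * p ^ (e %/ 2)); split=> //.
- by rewrite muln_gt0 s0 expn_gt0 prime_gt0.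
- rewrite coprimeMr ls /=; apply: coprimeXr.
  rewrite coprime_sym; apply: coprime_dvdr pm.
  by rewrite es addn1 expnS -mulnA dvdn_mulr.
- rewrite expnMn mulnA -es {1}en -expnM; congr (_ * _ ^ _); lia.
Qed.

Lemma unit6_divisor N a b : 0 < N -> a * b = 24 * N - 1 -> unit6 a.
Proof.
move=> N0 e; have ea := divn_eq a 6; have := ltn_pmod a (isT : 0 < 6).
rewrite /unit6; set q := a %/ 6 in ea; set r := a %% 6 in ea *.
have e2 : 6 * (q * b) + r * b = 24 * N - 1 by rewrite -e ea; lia.
by move: e2; case: r {ea} => [|[|[|[|[|[|r]]]]]] //; lia.
Qed.

(** Modulo 24, a ^ 2 = 1 and a b = -1, so a + b = a ^ 2 (a + b) = a (a ^ 2 + a b) = 0. *)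
Lemma dvdn24_add a b N : 0 < N -> a * b = 24 * N - 1 -> 24 %| a + b.
Proof.
move=> N0 e; have ea := pentagonalE (unit6_divisor N0 e).
have : 24 %| a ^ 2 * (a + b).
  have -> : a ^ 2 * (a + b) = a * (a ^ 2 + a * b) by ring.
  by rewrite dvdn_mull // e -ea; lia.
rewrite -ea mulnDl mul1n -mulnA [24 * _]mulnC mulnA dvdn_addr //.
exact: dvdn_mull.
Qed.

Lemma count_divisors_lt n : 0 < n -> (forall d, d * d != n) ->
  size (divisors n) = 2 * count (fun d => d * d < n) (divisors n).
Proof.
move=> n0 ns; rewrite -(count_predC (fun d => d * d < n)) mul2n -addnn; congr addn.
pose f d := n %/ d.
have fP d : d \in divisors n -> [/\ f d \in divisors n, f (f d) = d & d * f d = n].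
  rewrite -!dvdn_divisors // => dn; have [q eq] := dvdnP dn.
  have d0 := dvdn_gt0 n0 dn; have q0 : 0 < q by case: q eq n0 => // ->.
  by rewrite /f eq mulnK // mulKn // dvdn_mulr // mulnC.
apply: (@count_bij _ _ _ _ _ _ f f); rewrite ?divisors_uniq // => d /fP[fd ffd e] /= h.
  have := ns d; split=> //; nia.
have := ns d; split=> //; nia.
Qed.

Lemma not_square_24N1 N d : 0 < N -> d * d != 24 * N - 1.
Proof.
move=> N0; apply/eqP => e; have := pentagonalE (unit6_divisor N0 e).
by rewrite -mulnn e; lia.
Qed.

(** Each divisor a = 12 k - w below the square root has cofactor 12 k + w, and [dvdn24_add] recovers
    [k] from their sum. *)
Lemma count_factorisation N : 0 < N ->
  2 * count (factorisation N) (grid (24 * N + 1)) = size (divisors (24 * N - 1)).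
Proof.
move=> N0; have n0 : 0 < 24 * N - 1 by lia.
rewrite count_divisors_lt // => [|d]; last exact: not_square_24N1.
congr muln; pose f (x : nat * nat) := 12 * x.1 - x.2.
pose g a := let b := (24 * N - 1) %/ a in ((a + b) %/ 24, (b - a) %/ 2).
apply: (@count_bij _ _ _ _ _ _ f g); rewrite ?uniq_grid ?divisors_uniq //.
  move=> [k w]; rewrite mem_grid /factorisation /= => b /andP[wk /eqP].
  have [a ea a0] : exists2 a, 12 * k = w + a & 0 < a by exists (12 * k - w); lia.
  rewrite -!mulnn (_ : 144 * (k * k) = (12 * k) * (12 * k)); last by lia.
  rewrite {1 2}ea => e.
  have e2 : (a + 2 * w) * a = 24 * N - 1 by lia.
  rewrite /f /g /= ea addKn -e2 mulnK //; split.
  - by rewrite -dvdn_divisors ?dvdn_mull // e2.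
  - by rewrite ltn_mul2r; lia.
  - by congr pair; lia.
move=> a; rewrite -dvdn_divisors // => /dvdnP[b e] h.
have a0 : 0 < a by case: a e {h} => //; lia.
have /dvdnP[k ek] := dvdn24_add N0 (esym e).
rewrite /f /g /= e mulnK // in h *.
have ab : a < b by move: h; rewrite ltn_mul2r => /andP[].
have b6 := unit6_divisor N0 (esym e).
have a6 : unit6 a by apply: (@unit6_divisor N a b); rewrite // mulnC.
rewrite [a + b]addnC ek mulnK //.
have [w ew] : exists w, b = a + 2 * w.
  by exists ((b - a) %/ 2); move: a6 b6; rewrite /unit6; lia.
have -> : (b - a) %/ 2 = w by lia.
have kw : 12 * k = a + w by lia.
have e3 : (a + 2 * w) * a = 24 * N - 1 by rewrite -ew e.
split.
- rewrite mem_grid /=; have : a <= b * a by rewrite leq_pmull; lia.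
  have : b <= b * a by rewrite leq_pmulr.
  lia.
- rewrite /factorisation /=; apply/andP; split; first by lia.
  rewrite -!mulnn (_ : 144 * (k * k) = (12 * k) * (12 * k)); last by lia.
  by rewrite kw; apply/eqP; lia.
- by rewrite kw; lia.
Qed.

Theorem theorem1p5 (N : nat) (hN : (1 <= N)%N) :
  odd `|ospt N|%N <->
  exists l a m : nat,
    [/\ prime l, l = 23 %[mod 24], (1 <= m)%N, coprime l m
      & (24 * N - 1 = l ^ (4 * a + 1) * m ^ 2)%N].
Proof.
rewrite odd_ospt_factorisation // => [|E EN]; last first.
  by apply: odd_staircase_ternary; lia.
have n0 : 0 < 24 * N - 1 by lia.
have hc := count_factorisation hN.
have -> : odd (count (factorisation N) (grid (24 * N + 1))) <->
    size (divisors (24 * N - 1)) %% 4 = 2.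
  rewrite -hc; move: (count _ _) => c; have := modn2 c; split; lia.
rewrite size_divisors_mod4 //; split=> [] [l [a [m]]]; last first.
  by case=> lp _ m0 lm e; exists l, a, m.
case=> lp m0 lm e; exists l, a, m; split=> //.
(* Both [m ^ 2] and [l ^ (4 * a)] are squares of integers prime to 6, hence 1 modulo 24; so [l] is
   congruent to [24 * N - 1], that is to 23. *)
have m6 : unit6 m.
  by apply: (@unit6_divisor N _ (l ^ (4 * a + 1) * m)); rewrite // e; ring.
have l6 : unit6 (l ^ (2 * a)).
  by apply: (@unit6_divisor N _ (l ^ (2 * a + 1) * m ^ 2)); rewrite // e mulnA -expnD;
     congr (_ ^ _ * _); lia.
have em := pentagonalE m6; have el := pentagonalE l6.
have e2 : 24 * N - 1 = (l ^ (2 * a)) ^ 2 * m ^ 2 * l.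
  have ea : 4 * a + 1 = 2 * a * 2 + 1 by lia.
  by rewrite e ea expnD expnM expn1 mulnAC.
move: e2; rewrite -em -el.
set u := pentagonal _; set v := pentagonal _ => e2.
have e3 : 24 * N - 1 = 24 * (24 * (u * v * l) + u * l + v * l) + l by rewrite e2; lia.
by move: e3; lia.
Qed.
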